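(* For infinite time Turing machines, $\mathrm{NP}^+ \neq \text{co-NP}^+$, where $\text{co-NP}^+ = \{A \subset {}^{\omega}2 : {}^{\omega}2 \setminus A \in \mathrm{NP}^+\}$.
   Context: Infinite time Turing machines (Hamkins–Lewis): a machine has a finite program (finitely many states) and three one-way infinite tapes (input, scratch, output) with cells indexed by $\omega$, each cell holding $0$ or $1$, read by a single head that scans the same position on all three tapes. An input $x \in {}^{\omega}2$ is written on the input tape, the other tapes are initially all $0$, and the head starts at the leftmost cell in the start state. Successor steps of the computation proceed as for an ordinary Turing machine. At a limit ordinal stage the head is placed on the leftmost cell, the machine enters a designated limit state, and each cell takes as its value the limsup of its values at earlier stages. The machine halts when it enters a designated halt state. It accepts $x$ if it halts on input $x$ with output $1$. For $x,y \in {}^{\omega}2$, $x \oplus y \in {}^{\omega}2$ is the interleaving: $(x\oplus y)(2n)=x(n)$, $(x\oplus y)(2n+1)=y(n)$. For $x \in {}^{\omega}2$, $\omega_1^x$ is the least $x$-admissible ordinal greater than $\omega$. For $A \subset {}^{\omega}2$: $A \in \mathrm{NP}^+$ if there is an infinite time Turing machine $T$ such that (a) $x \in A$ if and only if there exists $y \in {}^{\omega}2$ such that $T$ accepts $x \oplus y$, and (b) $T$ halts on all inputs $x\oplus y$ after $<\omega_1^x$ many steps. *)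

(* Defs.v *)
From mathcomp Require Import all_boot.
From mathcomp Require Import boolp classical_sets.

Set Implicit Arguments.
Unset Strict Implicit.
Unset Printing Implicit Defensive.

Local Open Scope classical_set_scope.

(** * Sets and ordinals

    The cumulative hierarchy, as Aczel's type of well-founded trees: [VSet A f]
    is the set {f a | a : A}.  Equality of sets is [veq], not Leibniz equality. *)

Inductive V : Type := VSet (A : Type) (f : A -> V).

Definition idx (u : V) : Type := let: VSet A _ := u in A.
Definition elt (u : V) : idx u -> V := let: VSet _ f := u in f.

Fixpoint veq (u v : V) : Prop :=
  match u, v with
  | VSet A f, VSet B g =>
      (forall a, exists b, veq (f a) (g b)) /\
      (forall b, exists a, veq (f a) (g b))
  end.

Definition vin (u v : V) : Prop := exists i : idx v, veq u (elt i).
Definition vsub (u v : V) : Prop := forall w, vin w u -> vin w v.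

Definition vempty : V := VSet (fun e : void => match e with end).
Definition vsucc (u : V) : V :=
  VSet (fun o : option (idx u) => if o is Some i then elt i else u).
Definition vsep (u : V) (P : V -> Prop) : V :=
  VSet (fun i : {i : idx u | P (elt i)} => elt (sval i)).
Definition vbigcup (I : Type) (F : I -> V) : V :=
  VSet (fun p : {i : I & idx (F i)} => elt (projT2 p)).

Fixpoint vnat (n : nat) : V := if n is m.+1 then vsucc (vnat m) else vempty.
Definition vomega : V := VSet vnat.

Definition vtransitive (u : V) : Prop := forall v, vin v u -> vsub v u.

Definition ordinal_set (a : V) : Prop :=
  vtransitive a /\ forall b, vin b a -> vtransitive b.

Definition limit_ordinal (a : V) : Prop :=
  [/\ ordinal_set a, vin vempty a & forall b, vin b a -> vin (vsucc b) a].

(** * Relative constructibility and admissibility *)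

(** First-order formulas in the language with membership, equality and one unary
    predicate, with free variables in ['I_n].  A quantifier binds variable 0.
    Bounded quantification [FBEx i p], "there is v in the set i such that p", is
    primitive, so that Delta_0 formulas can be recognized syntactically. *)

Inductive form : nat -> Type :=
  | FIn n : 'I_n -> 'I_n -> form n
  | FEq n : 'I_n -> 'I_n -> form n
  | FPred n : 'I_n -> form n
  | FNot n : form n -> form n
  | FAnd n : form n -> form n -> form n
  | FEx n : form n.+1 -> form n
  | FBEx n : 'I_n -> form n.+1 -> form n.

Fixpoint delta0 n (p : form n) : bool :=
  match p with
  | FIn _ _ _ | FEq _ _ _ | FPred _ _ => true
  | FNot _ q => delta0 q
  | FAnd _ q r => delta0 q && delta0 r
  | FEx _ _ => false
  | FBEx _ _ q => delta0 q
  end.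

Definition econs n (v : V) (e : 'I_n -> V) : 'I_n.+1 -> V :=
  fun i => if unlift ord0 i is Some j then e j else v.

(** Satisfaction in the structure (M, in, x), where a real x in [nat -> bool]
    is the predicate {n in omega | x n = 1}. *)

Fixpoint sat (x : nat -> bool) (M : V) n (p : form n) : ('I_n -> V) -> Prop :=
  match p in form n return ('I_n -> V) -> Prop with
  | FIn _ i j => fun e => vin (e i) (e j)
  | FEq _ i j => fun e => veq (e i) (e j)
  | FPred _ i => fun e => exists2 k, x k & veq (e i) (vnat k)
  | FNot _ q => fun e => ~ sat x M q e
  | FAnd _ q r => fun e => sat x M q e /\ sat x M r e
  | FEx _ q => fun e => exists2 v, vin v M & sat x M q (econs v e)
  | FBEx _ i q =>
      fun e => exists v, [/\ vin v M, vin v (e i) & sat x M q (econs v e)]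
  end.

(** The set of subsets of M that are definable with parameters over (M, in, x). *)

Definition Def (x : nat -> bool) (M : V) : V :=
  VSet (fun d : {n : nat & (form n.+1 * ('I_n -> idx M))%type} =>
          let: existT n (p, c) := d in
          vsep M (fun v => sat x M p (econs v (fun i => elt (c i))))).

(** [Lrel x a] is L_a[x].  The usual clauses (L_0[x] empty,
    L_(b+1)[x] = Def of L_b[x], unions at limits) are merged into
    L_a[x] = the union over b in a of Def (L_b[x]). *)

Fixpoint Lrel (x : nat -> bool) (a : V) : V :=
  match a with VSet A f => vbigcup (fun i : A => Def x (Lrel x (f i))) end.

(** (M, in, x) is a model of Kripke-Platek set theory (without infinity),
    the schemes ranging over formulas that may mention the predicate x. *)

Record KP_model (x : nat -> bool) (M : V) : Prop := {
  KP_nonempty : exists a, vin a M;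
  KP_extensionality : forall a b, vin a M -> vin b M ->
    (forall c, vin c M -> (vin c a <-> vin c b)) -> veq a b;
  KP_foundation : forall n (p : form n.+1) (e : 'I_n -> V),
    (forall i, vin (e i) M) ->
    (exists2 a, vin a M & sat x M p (econs a e)) ->
    exists a, [/\ vin a M, sat x M p (econs a e) &
      forall b, vin b M -> vin b a -> ~ sat x M p (econs b e)];
  KP_pairing : forall a b, vin a M -> vin b M ->
    exists c, [/\ vin c M, vin a c & vin b c];
  KP_union : forall a, vin a M ->
    exists2 b, vin b M &
      forall c d, vin c M -> vin d M -> vin c a -> vin d c -> vin d b;
  KP_separation : forall n (p : form n.+1) (e : 'I_n -> V), delta0 p ->
    (forall i, vin (e i) M) ->
    forall a, vin a M ->
    exists2 b, vin b M &
      forall c, vin c M -> (vin c b <-> vin c a /\ sat x M p (econs c e));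
  KP_collection : forall n (p : form n.+2) (e : 'I_n -> V), delta0 p ->
    (forall i, vin (e i) M) ->
    forall a, vin a M ->
    (forall u, vin u M -> vin u a ->
       exists2 v, vin v M & sat x M p (econs v (econs u e))) ->
    exists2 b, vin b M &
      forall u, vin u M -> vin u a ->
        exists v, [/\ vin v M, vin v b & sat x M p (econs v (econs u e))]
}.

Definition admissible (x : nat -> bool) (a : V) : Prop :=
  ordinal_set a /\ KP_model x (Lrel x a).

Definition is_omega1 (x : nat -> bool) (a : V) : Prop :=
  [/\ admissible x a, vin vomega a &
      forall b, admissible x b -> vin vomega b -> vsub a b].

(** * Infinite time Turing machines *)

Inductive direction := MoveLeft | MoveRight.

(** Triples of bits are listed in the order input, scratch, output. *)

Record ittm := ITTM {
  state : finType;
  q_start : state;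
  q_limit : state;
  q_halt : state;
  program : state -> bool * bool * bool ->
            state * (bool * bool * bool) * direction;
  special_states_distinct : uniq [:: q_start; q_limit; q_halt]
}.

Record config (T : ittm) := Config {
  cstate : state T;
  chead : nat;
  cinput : nat -> bool;
  cscratch : nat -> bool;
  coutput : nat -> bool
}.

Definition init_config (T : ittm) (x : nat -> bool) : config T :=
  Config (q_start T) 0 x (fun=> false) (fun=> false).

Definition write (t : nat -> bool) (h : nat) (b : bool) : nat -> bool :=
  fun n => if n == h then b else t n.

(** A head on the leftmost cell that is told to move left stays there. *)

Definition step (T : ittm) (c : config T) : config T :=
  let h := chead c in
  let: (q, (bi, bs, bo), d) :=
    program (cstate c) (cinput c h, cscratch c h, coutput c h) in
  Config q (if d is MoveLeft then h.-1 else h.+1)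
    (write (cinput c) h bi) (write (cscratch c) h bs) (write (coutput c) h bo).

(** The limsup over b < l of the bits [f b] is 1. *)

Definition limsup1 (l : V) (f : V -> bool) : Prop :=
  forall b, vin b l -> exists g, [/\ vin g l, vsub b g & f g].

Definition is_limit_config (T : ittm) (h : V -> config T) (l : V)
    (c : config T) : Prop :=
  [/\ cstate c = q_limit T, chead c = 0,
      forall n, cinput c n <-> limsup1 l (fun b => cinput (h b) n),
      forall n, cscratch c n <-> limsup1 l (fun b => cscratch (h b) n) &
      forall n, coutput c n <-> limsup1 l (fun b => coutput (h b) n)].

(** [h] lists the configurations of T on input x along the ordinals.  For
    uniformity the transition rules are also followed after the halt state has
    been reached; [halts_at] only looks at the first time it is entered. *)

Definition is_run (T : ittm) (x : nat -> bool) (h : V -> config T) : Prop :=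
  [/\ forall a b, veq a b -> h a = h b,
      h vempty = init_config T x,
      forall a, ordinal_set a -> h (vsucc a) = step (h a) &
      forall l, limit_ordinal l -> is_limit_config h l (h l)].

(** T, on input x, halts at stage a in the configuration c. *)

Definition halts_at (T : ittm) (x : nat -> bool) (a : V) (c : config T) : Prop :=
  ordinal_set a /\
  exists h, [/\ is_run x h, h a = c, cstate c = q_halt T &
    forall b, vin b a -> cstate (h b) <> q_halt T].

(** The output is read off the leftmost cell of the output tape. *)

Definition accepts (T : ittm) (x : nat -> bool) : Prop :=
  exists a (c : config T), halts_at x a c /\ coutput c 0 = true.

Definition halts_before (T : ittm) (x : nat -> bool) (b : V) : Prop :=
  exists a (c : config T), halts_at x a c /\ vin a b.

Definition interleave (x y : nat -> bool) : nat -> bool :=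
  fun n => if odd n then y n./2 else x n./2.

(** * The classes *)

Definition NPplus : set (set (nat -> bool)) :=
  [set A | exists T : ittm,
     (forall x, A x <-> exists y, accepts T (interleave x y)) /\
     (forall x y, exists2 w, is_omega1 x w & halts_before T (interleave x y) w)].

Definition coNPplus : set (set (nat -> bool)) := [set A | NPplus (~` A)].

(* Main.v *)
(** A set in NP^+ is analytic: [x] belongs to it iff some real codes a linear
    order carrying an L[x]-hierarchy and an accepting run along that order.  If the
    order is ill-founded, overspill makes the level of L[x] at its well-founded
    part admissible, so the well-founded part is at least as long as omega_1^x and
    contains the whole halting computation, which must then be accepting.
    On the other hand a machine that stops at stage omega + 1 can follow a guessed
    infinite path through a graph that [x] lists as pairs of unary numbers; this
    yields a set in NP^+ to which every analytic set reduces by a map whose output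
    bits depend on strictly earlier input bits.  The fixed point of the map for its
    complement is a contradiction. *)
From Stdlib Require Import Setoid Morphisms.
From HB Require Import structures.
From mathcomp Require Import all_boot.
From mathcomp Require Import boolp classical_sets.
From mathcomp Require Import zify.
Require Import Defs.

Set Implicit Arguments.
Unset Strict Implicit.
Unset Printing Implicit Defensive.

(** * Sets and ordinals *)

(** Acceptance speaks of a run along a genuine ordinal, and well-foundedness is not an analytic
    condition. The time bound repairs this: an ill-founded guess is harmless once its well-founded
    part is known to reach [omega_1^x]. Of the axioms of KP only collection is at stake, because a
    limit level of L[x] satisfies all the others. So beyond local bookkeeping a guessed structure
    only has to satisfy one induction principle: if an instance of collection is realized in some
    level, it is realized in a least one. All this quantifies over numbers, formulas and finite
    tuples, hence is Borel.

    Analyticity is boldface: the closed relation [C] is arbitrary, the machine is fixed, and all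
    dependence on [C] goes into the real [diag C]. Its j-th stage lists the edge into the sequence
    with code j. A sequence is no longer than its code, so whether it belongs to the tree at
    [diag C] is decided by bits already written. Hence [diag C] is defined by plain recursion,
    without universal sets or a recursion theorem. *)

Lemma veq_refl u : veq u u.
Proof. by elim: u => A f IH /=; split=> a; exists a. Qed.

Lemma veq_sym u v : veq u v -> veq v u.
Proof.
elim: u v => A f IH [B g] /= [fg gf]; split=> [b|a].
- by have [a] := gf b; exists a; apply: IH.
- by have [b] := fg a; exists b; apply: IH.
Qed.

Lemma veq_trans u v w : veq u v -> veq v w -> veq u w.
Proof.
elim: u v w => A f IH [B g] [C h] /= [fg gf] [gh hg]; split=> [a|c].
- by have [b fgb] := fg a; have [c ghc] := gh b; exists c; apply: IH ghc.
- by have [b ghb] := hg c; have [a fga] := gf b; exists a; apply: IH ghb.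
Qed.

#[export] Instance veq_equiv : Equivalence veq.
Proof. by split; [exact: veq_refl | exact: veq_sym | exact: veq_trans]. Qed.

#[export] Hint Resolve veq_refl : core.

Lemma vin_elt u (i : idx u) : vin (elt i) u.
Proof. by exists i. Qed.

Lemma vin_eql u v w : veq u v -> vin v w -> vin u w.
Proof. by move=> uv [i vi]; exists i; apply: veq_trans vi. Qed.

Lemma vin_eqr u v w : veq v w -> vin u v -> vin u w.
Proof.
case: v w => [B g] [C h] [gh _] [b ub].
by have [c bc] := gh b; exists c; apply: veq_trans bc.
Qed.

#[export] Instance vin_proper : Proper (veq ==> veq ==> iff) vin.
Proof.
move=> u u' uu' v v' vv'; split=> uv.
- by apply: vin_eqr vv' _; apply: vin_eql uv; apply: veq_sym.
- by apply: vin_eqr (veq_sym vv') _; apply: vin_eql uv.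
Qed.

Lemma veqP u v : veq u v <-> (forall w, vin w u <-> vin w v).
Proof.
split=> [uv w|]; first by rewrite uv.
case: u v => [A f] [B g] uv /=; split=> [a|b].
- by have /uv : vin (f a) (VSet f) by exists a.
- have /uv [a ga] : vin (g b) (VSet g) by exists b.
  by exists a; apply: veq_sym.
Qed.

Lemma vin_ind (P : V -> Prop) :
  (forall u, (forall v, vin v u -> P v) -> P u) -> forall u, P u.
Proof.
(* Structural induction reaches only the listed elements; proving the claim for every tree [veq] to
   a given one covers all names of an element. *)
move=> H u; have: veq u u by [].
elim: u {1 3}u => A f IH v vu; apply: H => w wv.
have [a wa] : vin w (VSet f) by rewrite -vu.
exact: IH wa.
Qed.

Lemma vin_min (P : V -> Prop) : (exists u, P u) ->
  exists2 u, P u & forall v, vin v u -> ~ P v.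
Proof.
move=> [u Pu]; apply: contrapT => H.
suff: forall u, ~ P u by move/(_ u).
apply: vin_ind => v IH Pv; apply: H; exists v => //.
Qed.

Lemma vin_irrefl u : ~ vin u u.
Proof. by elim/vin_ind: u => u IH uu; exact: (IH u uu uu). Qed.

Lemma vin_asym u v : vin u v -> ~ vin v u.
Proof. by elim/vin_ind: u v => u IH v uv vu; apply: (IH v vu u). Qed.

Lemma vin_empty u : ~ vin u vempty.
Proof. by case=> -[]. Qed.

Lemma vemptyP u : (forall v, ~ vin v u) -> veq u vempty.
Proof. by move=> H; apply/veqP => w; split=> [/H //|/vin_empty]. Qed.

Lemma vin_succ u v : vin v (vsucc u) <-> vin v u \/ veq v u.
Proof.
split=> [[[i|]]|[[i vi]|vu]] /=; first by left; exists i.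
- by right.
- by exists (Some i).
- by exists None.
Qed.

Lemma vin_succ_diag u : vin u (vsucc u).
Proof. by apply/vin_succ; right. Qed.

Lemma vin_sep u (P : V -> Prop) v :
  (forall w w', vin w u -> veq w w' -> P w -> P w') ->
  vin v (vsep u P) <-> vin v u /\ P v.
Proof.
move=> Pp; split=> [[[i Pi] /= vi]|[[i vi] Pv]].
- split; first by exists i.
  by apply: (Pp (elt i)) Pi; [apply: vin_elt|apply: veq_sym].
- have Pi : P (elt i) by apply: (Pp v _ _ vi Pv); exists i.
  by exists (exist _ i Pi).
Qed.

Lemma vin_bigcup I (F : I -> V) v :
  vin v (vbigcup F) <-> exists i, vin v (F i).
Proof.
split=> [[[i j] /= vi]|[i [j vj]]]; first by exists i, j.
by exists (existT _ i j).
Qed.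

#[export] Instance vsucc_proper : Proper (veq ==> veq) vsucc.
Proof. by move=> u v uv; apply/veqP => w; rewrite !vin_succ uv. Qed.

#[export] Instance vsub_proper : Proper (veq ==> veq ==> iff) vsub.
Proof.
by move=> u u' uu' v v' vv'; split=> H w; [rewrite -uu' -vv'|rewrite uu' vv']; apply: H.
Qed.

Lemma vsucc_inj u v : veq (vsucc u) (vsucc v) -> veq u v.
Proof.
move=> uv.
have: vin u (vsucc v) by rewrite -uv; apply: vin_succ_diag.
have: vin v (vsucc u) by rewrite uv; apply: vin_succ_diag.
case/vin_succ => [vu|/veq_sym //] /vin_succ [uv'|//].
by case: (vin_asym uv' vu).
Qed.

#[export] Instance vtransitive_proper : Proper (veq ==> iff) vtransitive.
Proof.
move=> u v uv; split=> H w.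
- by rewrite -uv => /H; rewrite uv.
- by rewrite uv => /H; rewrite -uv.
Qed.

#[export] Instance ordinal_proper : Proper (veq ==> iff) ordinal_set.
Proof.
move=> u v uv; split=> -[H1 H2]; split.
- by rewrite -uv.
- by move=> b; rewrite -uv; apply: H2.
- by rewrite uv.
- by move=> b; rewrite uv; apply: H2.
Qed.

#[export] Instance limit_proper : Proper (veq ==> iff) limit_ordinal.
Proof.
move=> u v uv; split=> -[H1 H2 H3]; split.
- by rewrite -uv.
- by rewrite -uv.
- by move=> b; rewrite -uv; apply: H3.
- by rewrite uv.
- by rewrite uv.
- by move=> b; rewrite uv; apply: H3.
Qed.

Lemma ordinal_in a b : ordinal_set a -> vin b a -> ordinal_set b.
Proof.
by move=> [ta ha] ba; split=> [|c cb]; apply: ha => //; apply: ta ba _ cb.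
Qed.

Lemma ordinal_in_trans a b c : ordinal_set c -> vin a b -> vin b c -> vin a c.
Proof. by move=> [tc _] ab bc; apply: tc bc _ ab. Qed.

Lemma ordinal_succ a : ordinal_set a -> ordinal_set (vsucc a).
Proof.
move=> [ta ha]; split=> [b /vin_succ + c cb|b /vin_succ [/ha //|->//]].
by case=> [ba|ba]; apply/vin_succ; left; [apply: ta ba _ cb|rewrite -ba].
Qed.

Lemma ordinal_empty : ordinal_set vempty.
Proof. by split=> b /vin_empty. Qed.

Lemma ordinal_trichotomy a b : ordinal_set a -> ordinal_set b ->
  [\/ vin a b, veq a b | vin b a].
Proof.
elim/vin_ind: a b => a IHa; elim/vin_ind => b IHb oa ob.
have [[b' [b'b ab']]|nb] := pselect (exists b', vin b' b /\ (vin a b' \/ veq a b')).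
  by constructor 1; case: ab' => [ab'|->//]; apply: ordinal_in_trans ab' b'b.
have [[a' [a'a ba']]|na] := pselect (exists a', vin a' a /\ (vin b a' \/ veq b a')).
  by constructor 3; case: ba' => [ba'|->//]; apply: ordinal_in_trans ba' a'a.
constructor 2; apply/veqP => w; split=> [wa|wb].
- case: (IHa w wa b (ordinal_in oa wa) ob) => // H; case: na; exists w; split=> //.
  + by right; apply: veq_sym.
  + by left.
- case: (IHb w wb oa (ordinal_in ob wb)) => // H; case: nb; exists w; split=> //.
  + by left.
  + by right.
Qed.

Lemma ordinal_sub a b : ordinal_set a -> ordinal_set b ->
  vsub a b <-> ~ vin b a.
Proof.
move=> oa ob; split=> [ab /ab|ba]; first exact: vin_irrefl.
case: (ordinal_trichotomy oa ob) => // [ab w wa|->//].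
exact: ordinal_in_trans wa ab.
Qed.

Lemma ordinal_succ_le a b : ordinal_set b -> vin a b -> vin b (vsucc a) -> False.
Proof. by move=> ob ab /vin_succ [/(vin_asym ab)|E]//; move: ab; rewrite E => /vin_irrefl. Qed.

Lemma limit_ordinalP a : ordinal_set a -> limit_ordinal a <->
  (exists b, vin b a) /\ forall b, vin b a -> exists2 c, vin c a & vin b c.
Proof.
move=> oa; split=> [[_ ea sa]|[[b ba] H]].
  split=> [|b ba]; first by exists vempty.
  by exists (vsucc b); [apply: sa|apply: vin_succ_diag].
split=> // [|c ca].
- case: (ordinal_trichotomy ordinal_empty (ordinal_in oa ba)).
  + by move=> H'; apply: ordinal_in_trans H' ba.
  + by move->.
  + by move/vin_empty.
- have [d da cd] := H c ca.
  case: (ordinal_trichotomy (ordinal_succ (ordinal_in oa ca)) (ordinal_in oa da)).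
  + by move=> H'; apply: ordinal_in_trans H' da.
  + by move->.
  + by move/(ordinal_succ_le (ordinal_in oa da) cd).
Qed.

Lemma succ_eqP a b : ordinal_set a -> vin b a ->
  (forall c, vin c a -> ~ vin b c) -> veq a (vsucc b).
Proof.
move=> oa ba H; have ob := ordinal_in oa ba.
apply/veqP => w; rewrite vin_succ; split=> [wa|[wb|->//]].
- case: (ordinal_trichotomy (ordinal_in oa wa) ob); [by left|by right|].
  by move/(H _ wa).
- exact: ordinal_in_trans wb ba.
Qed.

Lemma ordinal_cases a : ordinal_set a ->
  [\/ veq a vempty, exists2 b, vin b a & veq a (vsucc b) | limit_ordinal a].
Proof.
move=> oa.
have [na|na] := pselect (exists b, vin b a); last first.
  by constructor 1; apply: vemptyP => v va; apply: na; exists v.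
have [H|H] := pselect (forall b, vin b a -> exists2 c, vin c a & vin b c).
  by constructor 3; apply/limit_ordinalP.
constructor 2; apply: contrapT => H'; apply: H => b ba.
apply: contrapT => nc; apply: H'; exists b => //.
by apply: succ_eqP => // c ca bc; apply: nc; exists c.
Qed.

Lemma ordinal_nat n : ordinal_set (vnat n).
Proof. by elim: n => [|n IH]; [apply: ordinal_empty|apply: ordinal_succ]. Qed.

Lemma vin_nat n v : vin v (vnat n) <-> exists2 m, m < n & veq v (vnat m).
Proof.
elim: n => [|n IH] /=; first by split=> [/vin_empty|[]].
rewrite vin_succ IH; split=> [[[m mn vm]|vn]|[m]].
- by exists m => //; apply: ltnW.
- by exists n.
- rewrite ltnS leq_eqVlt => /orP [/eqP->|mn] vm; first by right.
  by left; exists m.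
Qed.

Lemma vin_omega v : vin v vomega <-> exists n, veq v (vnat n).
Proof. by []. Qed.

Lemma ordinal_omega : ordinal_set vomega.
Proof.
split=> [u /vin_omega [n un] v|u /vin_omega [n ->]]; last by case: (ordinal_nat n).
by rewrite un => /vin_nat [m _ vm]; exists m.
Qed.

Lemma limit_omega : limit_ordinal vomega.
Proof.
split=> [||b /vin_omega [n bn]]; [exact: ordinal_omega|by exists 0|].
by exists n.+1; rewrite bn.
Qed.

Lemma vnat_inj m n : veq (vnat m) (vnat n) -> m = n.
Proof.
wlog: m n / m < n => [H|mn E].
  by case: (ltngtP m n) => // mn; [apply: H|move=> E; apply/esym; apply: H => //; apply: veq_sym].
by have: vin (vnat m) (vnat n); [apply/vin_nat; exists m|rewrite E => /vin_irrefl].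
Qed.

(** * Satisfaction in an arbitrary relational structure *)

Definition gcons U n (v : U) (e : 'I_n -> U) : 'I_n.+1 -> U :=
  fun i => if unlift ord0 i is Some j then e j else v.

Lemma gcons_pred U (D : U -> Prop) n v (e : 'I_n -> U) :
  D v -> (forall i, D (e i)) -> forall i, D (gcons v e i).
Proof. by move=> Dv De i; rewrite /gcons; case: unliftP. Qed.

Lemma gcons0 U n v (e : 'I_n -> U) : gcons v e ord0 = v.
Proof. by rewrite /gcons unlift_none. Qed.

Lemma gconsS U n v (e : 'I_n -> U) i : gcons v e (lift ord0 i) = e i.
Proof. by rewrite /gcons liftK. Qed.

(** Membership, equality, predicate and quantifier range are parameters, so that the same formula
    can be evaluated in a level of L[x] and in a structure on [nat] that imitates it. *)
Fixpoint gsat U (E Q : U -> U -> Prop) (R D : U -> Prop) n (p : form n) :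
    ('I_n -> U) -> Prop :=
  match p in form n return ('I_n -> U) -> Prop with
  | FIn _ i j => fun e => E (e i) (e j)
  | FEq _ i j => fun e => Q (e i) (e j)
  | FPred _ i => fun e => R (e i)
  | FNot _ q => fun e => ~ gsat E Q R D q e
  | FAnd _ q r => fun e => gsat E Q R D q e /\ gsat E Q R D r e
  | FEx _ q => fun e => exists v, D v /\ gsat E Q R D q (gcons v e)
  | FBEx _ i q =>
      fun e => exists v, [/\ D v, E v (e i) & gsat E Q R D q (gcons v e)]
  end.

Definition real_pred (x : nat -> bool) (v : V) : Prop :=
  exists2 k, x k & veq v (vnat k).

Lemma sat_gsat x M n (p : form n) e :
  sat x M p e <-> gsat vin veq (real_pred x) (vin^~ M) p e.
Proof.
elim: p e => //= {n} [n q IH|n q IHq r IHr|n q IH|n i q IH] e.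
- by rewrite IH.
- by rewrite IHq IHr.
- by split=> [[v vM H]|[v [vM H]]]; exists v => //; [split=> //|]; apply/IH.
- by split=> -[v [vM vi H]]; exists v; split=> //; apply/IH.
Qed.

(** A relation that is total in both directions and respects the basic relations is a bisimulation,
    so truth transfers along it. A map would be too rigid: sets matter only up to [veq], and several
    numbers may name the same set. *)
Lemma gsat_rel U (E Q : U -> U -> Prop) (R D : U -> Prop)
    U' (E' Q' : U' -> U' -> Prop) (R' D' : U' -> Prop) (S : U -> U' -> Prop) :
  (forall u, D u -> exists2 u', D' u' & S u u') ->
  (forall u', D' u' -> exists2 u, D u & S u u') ->
  (forall u v u' v', D u -> D v -> D' u' -> D' v' -> S u u' -> S v v' ->
     (E u v <-> E' u' v')) ->
  (forall u v u' v', D u -> D v -> D' u' -> D' v' -> S u u' -> S v v' ->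
     (Q u v <-> Q' u' v')) ->
  (forall u u', D u -> D' u' -> S u u' -> (R u <-> R' u')) ->
  forall n (p : form n) e e',
  (forall i, D (e i)) -> (forall i, D' (e' i)) -> (forall i, S (e i) (e' i)) ->
  gsat E Q R D p e <-> gsat E' Q' R' D' p e'.
Proof.
move=> forth back hE hQ hR n p.
have consS m v v' (e : 'I_m -> U) e' : S v v' -> (forall i, S (e i) (e' i)) ->
    forall i, S (gcons v e i) (gcons v' e' i).
  by move=> vv' ee' i; rewrite /gcons; case: unliftP.
elim: p => {n} [n i j|n i j|n i|n q IH|n q IHq r IHr|n q IH|n i q IH] e e' De De' ee' /=;
  try have IHc v v' : D v -> D' v' -> S v v' ->
    gsat E Q R D q (gcons v e) <-> gsat E' Q' R' D' q (gcons v' e');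
    try (by move=> Dv Dv' vv'; apply: IH; [apply: gcons_pred|apply: gcons_pred|apply: consS]).
- exact: hE.
- exact: hQ.
- exact: hR.
- by rewrite (IH e e').
- by rewrite (IHq e e') // (IHr e e').
- split=> [[v [Dv H]]|[v' [Dv' H]]].
  + have [v' Dv' vv'] := forth v Dv; exists v'; split=> //.
    by apply/(IHc v v' Dv Dv' vv').
  + have [v Dv vv'] := back v' Dv'; exists v; split=> //.
    by apply/(IHc v v' Dv Dv' vv').
- split=> [[v [Dv vi H]]|[v' [Dv' vi H]]].
  + have [v' Dv' vv'] := forth v Dv; exists v'; split=> //.
      by apply/(hE v (e i) v' (e' i)).
    by apply/(IHc v v' Dv Dv' vv').
  + have [v Dv vv'] := back v' Dv'; exists v; split=> //.
      by apply/(hE v (e i) v' (e' i)).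
    by apply/(IHc v v' Dv Dv' vv').
Qed.

(** Absoluteness: a bounded quantifier never leads out of [D], which contains all [E]-predecessors
    of its elements within [D']. *)
Lemma gsat_delta0 U (E Q : U -> U -> Prop) (R D D' : U -> Prop) :
  (forall u, D u -> D' u) -> (forall u w, D u -> D' w -> E w u -> D w) ->
  forall n (p : form n) e, delta0 p -> (forall i, D (e i)) ->
  gsat E Q R D p e <-> gsat E Q R D' p e.
Proof.
move=> sub tr n p.
elim: p => {n} [n i j|n i j|n i|n q IH|n q IHq r IHr|n q IH|n i q IH] e //= dp De.
- by rewrite IH.
- by case/andP: dp => dq dr; rewrite IHq // IHr.
- split=> -[v [Dv vi H]].
  + exists v; split=> //; first exact: sub.
    by apply/IH => //; apply: gcons_pred.
  + have Dv' : D v by apply: tr vi.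
    by exists v; split=> //; apply/IH => //; apply: gcons_pred.
Qed.

Lemma sat_veq x M M' n (p : form n) e e' : veq M M' ->
  (forall i, vin (e i) M) -> (forall i, veq (e i) (e' i)) ->
  sat x M p e <-> sat x M' p e'.
Proof.
move=> MM' eM ee'; rewrite !sat_gsat; apply: (gsat_rel (S := veq)) => //.
- by move=> u uM; exists u; rewrite -?MM'.
- by move=> u uM; exists u; rewrite ?MM'.
- by move=> u v u' v' _ _ _ _ -> ->.
- by move=> u v u' v' _ _ _ _ -> ->.
- by move=> u u' _ _ uu'; split=> -[k xk]; [rewrite uu'|rewrite -uu'] => E; exists k.
- by move=> i; rewrite -ee' -MM'.
Qed.

Lemma sat_veq_imp x M M' n (p : form n) e e' : veq M M' ->
  (forall i, vin (e i) M) -> (forall i, veq (e i) (e' i)) ->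
  sat x M p e -> sat x M' p e'.
Proof. by move=> MM' eM ee' H; apply/(sat_veq x p MM' eM ee'). Qed.

Lemma sat_delta0 x M M' n (p : form n) e : vsub M M' -> vtransitive M ->
  delta0 p -> (forall i, vin (e i) M) -> sat x M p e <-> sat x M' p e.
Proof.
move=> sub tr dp eM; rewrite !sat_gsat; apply: gsat_delta0 => // u w uM _ wu.
exact: tr uM _ wu.
Qed.

(** * Definable subsets and the levels of L[x] *)

Definition defines x M n (p : form n.+1) (e : 'I_n -> V) (v : V) : Prop :=
  (forall i, vin (e i) M) /\
  forall w, vin w v <-> vin w M /\ sat x M p (econs w e).

Lemma econs_veq n v v' (e e' : 'I_n -> V) : veq v v' ->
  (forall i, veq (e i) (e' i)) -> forall i, veq (econs v e i) (econs v' e' i).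
Proof. by move=> vv' ee' i; rewrite /econs; case: unliftP. Qed.

Lemma vsepP x M n (p : form n.+1) (e : 'I_n -> V) v : (forall i, vin (e i) M) ->
  veq v (vsep M (fun w => sat x M p (econs w e))) <-> defines x M p e v.
Proof.
move=> eM.
have E w : vin w (vsep M (fun w => sat x M p (econs w e))) <->
    vin w M /\ sat x M p (econs w e).
  apply: vin_sep => {}w w' wM ww' H; apply/(@sat_veq x M M _ p (econs w e)) => //.
  - exact: (gcons_pred (D := vin^~ M)).
  - exact: econs_veq.
split=> [vE|[_ vE]]; last by apply/veqP => w; rewrite E vE.
by split=> // w; rewrite vE E.
Qed.

Lemma vin_Def x M v : vin v (Def x M) <-> exists n (p : form n.+1) e, defines x M p e v.
Proof.
split=> [[[n [p c]] /= vE]|[n [p [e vE]]]].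
  by exists n, p, (fun i => elt (c i)); apply/vsepP => // i; apply: vin_elt.
have [c cE] := choice (proj1 vE).
exists (existT _ n (p, c)) => /=.
have ce i : vin (elt (c i)) M by apply: vin_elt.
apply/(vsepP _ _ v ce); split=> // w; rewrite (proj2 vE w).
split=> -[wM H]; split=> //; move: H; apply: sat_veq_imp => //.
- exact: (gcons_pred (D := vin^~ _) wM (proj1 vE)).
- exact: econs_veq.
- exact: (gcons_pred (D := vin^~ _)).
- by apply: econs_veq => // i; apply: veq_sym.
Qed.

#[export] Instance Def_proper x : Proper (veq ==> veq) (Def x).
Proof.
suff H M M' v : veq M M' -> vin v (Def x M) -> vin v (Def x M').
  by move=> M M' MM'; apply/veqP => v; split; apply: H; rewrite MM'.
move=> MM' /vin_Def [n [p [e [eM vE]]]]; apply/vin_Def; exists n, p, e.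
split=> [i|w]; first by rewrite -MM'.
have M'M := veq_sym MM'.
rewrite vE; split=> -[wM H]; (split; first by rewrite ?MM' // M'M);
  move: H; apply: sat_veq_imp => //.
- exact: (gcons_pred (D := vin^~ _)).
- by apply: (gcons_pred (D := vin^~ _)) => // i; rewrite -MM'.
Qed.

#[export] Instance Lrel_proper x : Proper (veq ==> veq) (Lrel x).
Proof.
move=> u; elim: u => A f IH [B g] [fg gf]; apply/veqP => w.
rewrite /= !vin_bigcup; split=> [[a]|[b]].
- by have [b ab] := fg a; rewrite (IH _ _ ab); exists b.
- by have [a ab] := gf b; rewrite -(IH _ _ ab); exists a.
Qed.

Lemma vin_Lrel x a v :
  vin v (Lrel x a) <-> exists2 b, vin b a & vin v (Def x (Lrel x b)).
Proof.
case: a => A f /=; rewrite vin_bigcup; split=> [[i vi]|[b [i bi]]].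
- by exists (f i) => //; exists i.
- by rewrite bi; exists i.
Qed.

Lemma vsub_Def x M v : vin v (Def x M) -> vsub v M.
Proof. by case/vin_Def => n [p [e [_ vE]]] w /vE []. Qed.

Lemma Lrel_mono x a b : vsub a b -> vsub (Lrel x a) (Lrel x b).
Proof. by move=> ab v /vin_Lrel [c /ab cb vc]; apply/vin_Lrel; exists c. Qed.

Lemma Lrel_trans x a : vtransitive a -> vtransitive (Lrel x a).
Proof.
move=> ta v /vin_Lrel [b ba /vsub_Def vb] w /vb.
by apply: Lrel_mono; apply: ta.
Qed.

Lemma Lrel_in x a b : vin b a -> vin (Lrel x b) (Lrel x a).
Proof.
move=> ba; apply/vin_Lrel; exists b => //; apply/vin_Def.
exists 0, (FEq ord0 ord0), (fun i => Lrel x b); split=> [[]//|w] /=.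
by split=> [|[]].
Qed.

(* [L_a], [a] a limit, satisfies every axiom of KP except perhaps collection. *)
Lemma Lrel_KP x a : limit_ordinal a ->
  (forall n (p : form n.+2) (e : 'I_n -> V), delta0 p ->
    (forall i, vin (e i) (Lrel x a)) ->
    forall d, vin d (Lrel x a) ->
    (forall u, vin u (Lrel x a) -> vin u d ->
       exists2 v, vin v (Lrel x a) & sat x (Lrel x a) p (econs v (econs u e))) ->
    exists2 c, vin c a & forall u, vin u (Lrel x a) -> vin u d ->
       exists2 v, vin v (Lrel x c) & sat x (Lrel x a) p (econs v (econs u e))) ->
  KP_model x (Lrel x a).
Proof.
move=> la coll; have [oa ea sa] := la.
have [ta _] := oa; have trL := Lrel_trans (x := x) ta.
have ord_trans b : vin b a -> vtransitive (Lrel x b).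
  by move=> /(ordinal_in oa) [tb _]; apply: Lrel_trans.
have sub b : vin b a -> vsub (Lrel x b) (Lrel x a).
  by move=> /ta; apply: Lrel_mono.
have max b c : vin b a -> vin c a -> exists d, [/\ vin d a, vsub b d & vsub c d].
  move=> ba ca; have [ob oc] := (ordinal_in oa ba, ordinal_in oa ca).
  case: (ordinal_trichotomy ob oc) => [bc|bc|cb].
  - by exists c; split=> // w; apply: (proj1 oc).
  - by exists c; split=> //; rewrite bc.
  - by exists b; split=> // w; apply: (proj1 ob).
have level v : vin v (Lrel x a) -> exists2 b, vin b a & vin v (Lrel x b).
  move=> /vin_Lrel [b ba vb]; exists (vsucc b); first exact: sa.
  by apply/vin_Lrel; exists b => //; apply: vin_succ_diag.
have level2 u v : vin u (Lrel x a) -> vin v (Lrel x a) ->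
    exists b, [/\ vin b a, vin u (Lrel x b) & vin v (Lrel x b)].
  move=> /level [b ba ub] /level [c ca vc]; have [d [da bd cd]] := max b c ba ca.
  by exists d; split=> //; [apply: Lrel_mono bd _ ub|apply: Lrel_mono cd _ vc].
have levels n (e : 'I_n -> V) : (forall i, vin (e i) (Lrel x a)) ->
    exists2 b, vin b a & forall i, vin (e i) (Lrel x b).
  elim: n e => [|n IH] e eL; first by exists vempty => // -[].
  have [b ba eb] := IH (fun i => e (lift ord0 i)) (fun i => eL _).
  have [c ca ec] := level _ (eL ord0).
  have [d [da bd cd]] := max _ _ ba ca; exists d => // i.
  by have [j ->|->] := unliftP ord0 i; [apply: Lrel_mono bd _ _|apply: Lrel_mono cd _ _].
have def b n (p : form n.+1) (e : 'I_n -> V) : vin b a ->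
    (forall i, vin (e i) (Lrel x b)) ->
    exists2 v, vin v (Lrel x a) & forall w, vin w v <->
      vin w (Lrel x b) /\ sat x (Lrel x b) p (econs w e).
  move=> ba eb; pose v := vsep (Lrel x b) (fun w => sat x (Lrel x b) p (econs w e)).
  have dv : defines x (Lrel x b) p e v by apply/vsepP.
  exists v; last exact: (proj2 dv).
  by apply/vin_Lrel; exists b => //; apply/vin_Def; exists n, p, e.
split.
- by exists (Lrel x vempty); apply: Lrel_in.
- move=> u v uL vL uv; apply/veqP => w; split=> [wu|wv].
  + by apply/uv => //; apply: trL uL _ wu.
  + by apply/uv => //; apply: trL vL _ wv.
- move=> n p e eL [d0 d0L sd0].
  have [d [dL sd] dmin] := vin_min (ex_intro (fun v => vin v (Lrel x a) /\
    sat x (Lrel x a) p (econs v e)) d0 (conj d0L sd0)).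
  by exists d; split=> // b bL bd sb; apply: (dmin b bd).
- move=> u v uL vL; have [b [ba ub vb]] := level2 u v uL vL.
  exists (Lrel x b); split=> //; exact: Lrel_in.
- move=> u uL; have [b ba ub] := level u uL.
  exists (Lrel x b); first exact: Lrel_in.
  by move=> c d _ _ cu; apply: (ord_trans b ba c); apply: (ord_trans b ba u).
- move=> n p e dp eL u uL.
  have [b ba eb] := levels _ (gcons u e) (gcons_pred (D := vin^~ _) uL eL).
  have ub : vin u (Lrel x b) by have := eb ord0; rewrite gcons0.
  have {}eb i : vin (e i) (Lrel x b) by have := eb (lift ord0 i); rewrite gconsS.
  (* [v] is the set of all elements of the level [b] with property [p]. It is intersected with [u]
     over a higher level [c], by a formula in the parameters [u] and [v]; this avoids renaming the
     variables of [p]. *)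
  have [v vL vE] := def b _ p e ba eb.
  have [c [ca uc vc]] := level2 u v uL vL.
  have uvc (i : 'I_2) : vin (if i == ord0 then u else v) (Lrel x c) by case: ifP.
  have [w wL wE] := def c _ (FAnd (FIn ord0 (lift ord0 ord0))
    (FIn ord0 (lift ord0 ord_max))) _ ca uvc.
  exists w => // d dL; rewrite wE /= /econs !unlift_none !liftK /= vE.
  have sE : vin d (Lrel x b) -> sat x (Lrel x b) p (econs d e) <->
      sat x (Lrel x a) p (econs d e).
    move=> db; apply: sat_delta0 => //; [exact: sub|exact: ord_trans|].
    exact: (gcons_pred (D := vin^~ _)).
  split=> [[dc [du [db]]]|[du sd]]; first by move=> /(sE db).
  have db : vin d (Lrel x b) by apply: (ord_trans b ba u).
  by split; [apply: (ord_trans c ca u)|do ![split=> //]; apply/sE].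
- move=> n p e dp eL u uL uv.
  have [c ca cv] := coll n p e dp eL u uL uv.
  exists (Lrel x c); first exact: Lrel_in.
  move=> w wL wu; have [v vc sv] := cv w wL wu.
  by exists v; split=> //; apply: sub vc.
Qed.

(** * Countability of formulas and of definable subsets *)

Fixpoint form_of_tree (t : GenTree.tree nat) n : option (form n) :=
  match t with
  | GenTree.Node 0 [:: GenTree.Leaf i; GenTree.Leaf j] =>
      if (insub i, insub j) is (Some i', Some j') then Some (FIn i' j') else None
  | GenTree.Node 1 [:: GenTree.Leaf i; GenTree.Leaf j] =>
      if (insub i, insub j) is (Some i', Some j') then Some (FEq i' j') else None
  | GenTree.Node 2 [:: GenTree.Leaf i] =>
      if insub i is Some i' then Some (FPred i') else None
  | GenTree.Node 3 [:: s] => omap (@FNot n) (form_of_tree s n)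
  | GenTree.Node 4 [:: s; r] =>
      if (form_of_tree s n, form_of_tree r n) is (Some p, Some q)
      then Some (FAnd p q) else None
  | GenTree.Node 5 [:: s] => omap (@FEx n) (form_of_tree s n.+1)
  | GenTree.Node 6 [:: GenTree.Leaf i; s] =>
      if (insub i, form_of_tree s n.+1) is (Some i', Some p)
      then Some (FBEx i' p) else None
  | _ => None
  end.

(** A partial decoder that hits every formula already gives countability of each member of the
    indexed family [form]. *)
Lemma form_of_tree_surj n (p : form n) : exists t, form_of_tree t n = Some p.
Proof.
elim: p => {n} [n i j|n i j|n i|n q [s IH]|n q [s IHq] r [t IHr]|n q [s IH]|n i q [s IH]].
- by exists (GenTree.Node 0 [:: GenTree.Leaf (val i); GenTree.Leaf (val j)]); rewrite /= !valK.
- by exists (GenTree.Node 1 [:: GenTree.Leaf (val i); GenTree.Leaf (val j)]); rewrite /= !valK.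
- by exists (GenTree.Node 2 [:: GenTree.Leaf (val i)]); rewrite /= !valK.
- by exists (GenTree.Node 3 [:: s]); rewrite /= IH.
- by exists (GenTree.Node 4 [:: s; t]); rewrite /= IHq IHr.
- by exists (GenTree.Node 5 [:: s]); rewrite /= IH.
- by exists (GenTree.Node 6 [:: GenTree.Leaf (val i); s]); rewrite /= IH valK.
Qed.

Definition enumerable (S : V -> Prop) : Prop :=
  exists g : nat -> V, forall v, S v -> exists n, veq v (g n).

Lemma enumerable_sub (S S' : V -> Prop) :
  (forall v, S v -> S' v) -> enumerable S' -> enumerable S.
Proof. by move=> sub [g gP]; exists g => v /sub /gP. Qed.

Lemma enumerable_bigcup (S : nat -> V -> Prop) :
  (forall n, enumerable (S n)) -> enumerable (fun v => exists n, S n v).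
Proof.
move=> /choice [g gP].
exists (fun k => if unpickle k is Some (n, m) then g n m else vempty) => v [n /gP [m vm]].
by exists (pickle (n, m)); rewrite pickleK.
Qed.

Lemma enumerableU (S S' : V -> Prop) :
  enumerable S -> enumerable S' -> enumerable (fun v => S v \/ S' v).
Proof.
move=> eS eS'.
apply: (@enumerable_sub _ (fun v => exists n, if n is 0 then S v else S' v)).
  by move=> v [Sv|Sv]; [exists 0|exists 1].
by apply: enumerable_bigcup => -[].
Qed.

Lemma enumerable1 u : enumerable (fun v => veq v u).
Proof. by exists (fun=> u) => v; exists 0. Qed.

Lemma defines_veq x M n (p : form n.+1) (e e' : 'I_n -> V) v :
  (forall i, veq (e i) (e' i)) -> defines x M p e v -> defines x M p e' v.
Proof.
move=> ee' [eM vE]; have e'M i : vin (e' i) M by rewrite -ee'.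
split=> // w; rewrite vE; split=> -[wM H]; (split=> //); move: H.
- by apply: sat_veq_imp => //; [exact: (gcons_pred (D := vin^~ _))|apply: econs_veq].
- apply: sat_veq_imp => //; first exact: (gcons_pred (D := vin^~ _)).
  by apply: econs_veq => // i; symmetry.
Qed.

Lemma enumerable_Def x M :
  enumerable (vin^~ M) -> enumerable (vin^~ (Def x M)).
Proof.
move=> [g gP].
pose dec (k : nat) : V :=
  if unpickle k is Some (n, t, s) then
    if form_of_tree t n.+1 is Some p then
      vsep M (fun w => sat x M p (econs w (fun i : 'I_n => g (nth 0 s i))))
    else vempty
  else vempty.
exists dec => v /vin_Def [n [p [e dv]]].
have [c cE] := choice (fun i => gP _ (proj1 dv i)).
have [t tE] := form_of_tree_surj p.
exists (pickle (n, t, [seq c i | i <- enum 'I_n])).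
rewrite /dec pickleK tE.
have eqs (i : 'I_n) : nth 0 [seq c i | i <- enum 'I_n] i = c i.
  by rewrite (nth_map i) ?size_enum_ord // nth_ord_enum.
have {}cE i : veq (e i) (g (nth 0 [seq c i | i <- enum 'I_n] i)) by rewrite eqs.
have {}dv := defines_veq cE dv.
by apply/vsepP => //; case: dv.
Qed.

(** * A sufficiently large ordinal *)

(** These trees denote the countable ordinals. A sequence of trees is again a tree, which makes the
    regularity of [vomega1] immediate. *)
Inductive ctree := CLeaf | CNode (f : nat -> ctree).

Fixpoint cord (t : ctree) : V :=
  if t is CNode f then vbigcup (fun n => vsucc (cord (f n))) else vempty.

(* The first uncountable ordinal; only its regularity matters. *)
Definition vomega1 : V := VSet cord.

Lemma vin_cord f v :
  vin v (cord (CNode f)) <-> exists n, vin v (cord (f n)) \/ veq v (cord (f n)).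
Proof. by rewrite /= vin_bigcup; split=> -[n /vin_succ]; exists n => //; apply/vin_succ. Qed.

Lemma ordinal_cord t : ordinal_set (cord t).
Proof.
elim: t => [|f IH]; first exact: ordinal_empty.
split=> [u /vin_cord [n un] v vu|u /vin_cord [n un]].
  apply/vin_cord; exists n; left; case: un => [un|<-//].
  exact: ordinal_in_trans vu un.
by case: un => [/(proj2 (IH n))//|->]; case: (IH n).
Qed.

Lemma vin_cord_ex t v : vin v (cord t) -> exists s, veq v (cord s).
Proof.
by elim: t => [/vin_empty//|f IH] /vin_cord [n [/IH//|vn]]; exists (f n).
Qed.

Lemma ordinal_omega1 : ordinal_set vomega1.
Proof.
split=> [u [t ut] v|u [t ->]]; last by case: (ordinal_cord t).
by rewrite ut => /vin_cord_ex [s vs]; exists s.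
Qed.

Lemma limit_omega1 : limit_ordinal vomega1.
Proof.
apply/(limit_ordinalP ordinal_omega1); split; first by exists vempty, CLeaf.
move=> b [t bt]; exists (cord (CNode (fun=> t))); first by exists (CNode (fun=> t)).
by apply/vin_cord; exists 0; right.
Qed.

Fixpoint nat_tree n : ctree := if n is m.+1 then CNode (fun=> nat_tree m) else CLeaf.

Lemma cord_nat n : veq (cord (nat_tree n)) (vnat n).
Proof.
elim: n => // n IH; apply/veqP => w.
apply: iff_trans (vin_cord (fun=> nat_tree n) w) _.
apply: iff_trans _ (iff_sym (vin_succ _ _)).
by split=> [[_]|H]; [|exists 0]; rewrite ?IH // -?IH.
Qed.

Lemma cord_omega : veq (cord (CNode nat_tree)) vomega.
Proof.
apply/veqP => w; rewrite vin_cord vin_omega; split=> [[n]|[n wn]].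
- by rewrite cord_nat vin_nat => -[[m _ wm]|wn]; [exists m|exists n].
- by exists n; rewrite cord_nat; right.
Qed.

Lemma enumerable_cord t : enumerable (vin^~ (cord t)).
Proof.
elim: t => [|f IH]; first by exists (fun=> vempty) => v /vin_empty.
apply: (@enumerable_sub _ (fun v => exists n, vin v (cord (f n)) \/ veq v (cord (f n)))).
  by move=> v /vin_cord.
by apply: enumerable_bigcup => n; apply: enumerableU (enumerable1 _).
Qed.

Lemma enumerable_Lrel_cord x t : enumerable (vin^~ (Lrel x (cord t))).
Proof.
elim: t => [|f IH].
  by exists (fun=> vempty) => v /vin_Lrel [b /vin_empty].
apply: (@enumerable_sub _ (fun v => exists n, vin v (Lrel x (cord (f n))) \/
    vin v (Def x (Lrel x (cord (f n)))))).
  move=> v /vin_Lrel [b /vin_cord [n bn] vb]; exists n.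
  case: bn => [bn|bn]; last by right; rewrite -bn.
  by left; apply/vin_Lrel; exists b.
apply: enumerable_bigcup => n.
apply: (@enumerableU (vin^~ _) (vin^~ (Def x (Lrel x (cord (f n)))))) => //.
exact: enumerable_Def.
Qed.

(** For collection, the given set lies in a countable level. A level containing a witness is chosen
    for each index of an enumeration, and the node over these choices bounds them all. *)
Lemma admissible_omega1 x : admissible x vomega1.
Proof.
split; first exact: ordinal_omega1.
apply: (Lrel_KP limit_omega1) => n p e _ eL d dL dv.
have [t dt] : exists t, vsub d (Lrel x (cord t)).
  have /vin_Lrel [b [t bt] /vsub_Def db] := dL.
  by exists t => w /db; rewrite bt.
have [g gP] := enumerable_Lrel_cord x t.
have : forall k, exists s : ctree, vin (g k) d ->
    exists v, [/\ vin v (Lrel x (cord s)), vin v (Lrel x vomega1) &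
      sat x (Lrel x vomega1) p (econs v (econs (g k) e))].
  move=> k; have [kd|] := pselect (vin (g k) d); last by exists CLeaf.
  have kL : vin (g k) (Lrel x vomega1).
    exact: Lrel_trans (proj1 ordinal_omega1) _ dL _ kd.
  have [v vL sv] := dv _ kL kd; have /vin_Lrel [b [s bs] vb] := vL.
  exists (CNode (fun=> s)) => _; exists v; split=> //.
  by apply/vin_Lrel; exists b => //; apply/vin_cord; exists 0; right.
move=> /choice [s sP]; exists (cord (CNode s)); first by exists (CNode s).
move=> u uL ud; have [k uk] := gP u (dt u ud).
have kd : vin (g k) d by rewrite -uk.
have [v [vs vL sv]] := sP k kd; exists v.
  apply: Lrel_mono vs => w ws; apply/vin_cord; exists k; by left.
move: sv; apply: sat_veq_imp => //.
  apply: (gcons_pred (D := vin^~ _)) => //; apply: (gcons_pred (D := vin^~ _)) => //.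
  by rewrite -uk.
by apply: econs_veq => //; apply: econs_veq; [symmetry|].
Qed.

(** The bound by [vomega1] makes every stage below [omega_1^x] countable, so that a halting run can
    be copied onto [nat]. *)
Lemma omega1_exists x : exists2 w, is_omega1 x w & vsub w vomega1.
Proof.
have om : vin vomega vomega1 by exists (CNode nat_tree); symmetry; apply: cord_omega.
have [w [aw ow] wmin] := vin_min (ex_intro (fun w => admissible x w /\ vin vomega w)
  vomega1 (conj (admissible_omega1 x) om)).
have sub b : admissible x b -> vin vomega b -> vsub w b.
  move=> ab ob; apply/ordinal_sub; [by case: aw|by case: ab|].
  by move=> /wmin; apply.
by exists w; [split|apply: sub => //; apply: admissible_omega1].
Qed.

(** * Runs *)

#[local] Arguments veq : simpl never.

(** The recursion follows the tree, so the kind of ordinal is decided by comparing the tree with the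
    successors of its listed elements. *)
Fixpoint run_at (T : ittm) (x : nat -> bool) (a : V) : config T :=
  match a with
  | VSet A f =>
      if pselect (exists i, veq (VSet f) (vsucc (f i))) is left ai
      then step (run_at T x (f (projT1 (cid ai))))
      else if `[< exists i : A, True >] then
        let limsup (t : config T -> nat -> bool) n :=
          `[< forall i, exists j, vsub (f i) (f j) /\ t (run_at T x (f j)) n >] in
        Config (q_limit T) 0
          (limsup (@cinput T)) (limsup (@cscratch T)) (limsup (@coutput T))
      else init_config T x
  end.

Section Runs.
Variable T : ittm.
Implicit Types (x : nat -> bool) (h : V -> config T).

Lemma config_eq (c c' : config T) : cstate c = cstate c' -> chead c = chead c' ->
  (forall n, cinput c n <-> cinput c' n) ->
  (forall n, cscratch c n <-> cscratch c' n) ->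
  (forall n, coutput c n <-> coutput c' n) -> c = c'.
Proof.
case: c c' => [q k i s o] [q' k' i' s' o'] /= -> -> hi hs ho.
have ext (t t' : nat -> bool) : (forall n, t n <-> t' n) -> t = t'.
  by move=> tt'; apply/funext => n; apply/idP/idP => /tt'.
by rewrite (ext _ _ hi) (ext _ _ hs) (ext _ _ ho).
Qed.

Lemma run_at_veq x a b : veq a b -> run_at T x a = run_at T x b.
Proof.
elim: a b => A f IH [B g] ab.
have [fg gf] : (forall i, exists j, veq (f i) (g j)) /\
  (forall j, exists i, veq (f i) (g j)) := ab.
rewrite /=.
case: pselect => [ai|na]; case: pselect => [bj|nb].
- case: (cid ai) => i /= fi; case: (cid bj) => j /= gj; rewrite (IH i (g j)) //.
  by apply: vsucc_inj; rewrite -fi -gj.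
- case: nb; have [i fi] := ai; have [j fgij] := fg i; exists j.
  by rewrite -ab fi fgij.
- case: na; have [j gj] := bj; have [i fgij] := gf j; exists i.
  by rewrite ab gj fgij.
- have -> : `[< exists _ : A, True >] = `[< exists _ : B, True >].
    by apply: asbool_equiv_eq; split=> -[c _]; [have [d _] := fg c|have [d _] := gf c]; exists d.
  case: ifP => // _.
  have lim (t : config T -> nat -> bool) n :
      `[< forall i, exists j, vsub (f i) (f j) /\ t (run_at T x (f j)) n >] =
      `[< forall i, exists j, vsub (g i) (g j) /\ t (run_at T x (g j)) n >].
    apply: asbool_equiv_eq; split=> H k.
    - have [i ik] := gf k; have [j [ij tj]] := H i; have [l jl] := fg j.
      by exists l; split; [rewrite -ik -jl|rewrite -(IH _ _ jl)].
    - have [i ki] := fg k; have [j [ij tj]] := H i; have [l jl] := gf j.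
      by exists l; split; [rewrite ki jl|rewrite (IH _ _ jl)].
  by f_equal; apply/funext => n; apply: lim.
Qed.

Lemma run_at_run x : is_run x (run_at T x).
Proof.
split; first exact: run_at_veq.
- rewrite /vempty /=; case: pselect => [[[]]|_].
  by rewrite ifF //; apply/asboolP => -[[]].
- move=> [A f] _; rewrite [LHS]/=.
  case: pselect => [ai|[]]; last by exists None.
  case: (cid ai) => i ai'; congr step; apply: run_at_veq; symmetry.
  exact: (vsucc_inj (u := VSet f) ai').
- move=> [A f] lim; have [ol el sl] := lim.
  rewrite [X in is_limit_config _ _ X]/=.
  case: pselect => [[i /= fi]|_].
    have : vin (vsucc (f i)) (VSet f) by apply: sl; exists i.
    by rewrite -fi => /vin_irrefl.
  have -> : `[< exists _ : A, True >] by apply/asboolP; have [i _] := el; exists i.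
  have limsupP (t : config T -> nat -> bool) n :
      `[< forall i, exists j, vsub (f i) (f j) /\ t (run_at T x (f j)) n >] <->
      limsup1 (VSet f) (fun b => t (run_at T x b) n).
    split=> [/asboolP H b [i bi]|H].
      have [j [ij tj]] := H i; exists (f j); split=> //; first by exists j.
      by rewrite bi.
    apply/asboolP => i; have [|b [[j bj] ib tb]] := H (f i); first by exists i.
    have {}bj : veq b (f j) := bj.
    by exists j; split; [rewrite -bj|rewrite -(run_at_veq x bj)].
  by split=> // n; apply: limsupP.
Qed.

Lemma limit_config_eq h h' l c c' : is_limit_config h l c ->
  is_limit_config h' l c' -> (forall b, vin b l -> h b = h' b) -> c = c'.
Proof.
move=> [sc hc ic cc oc] [sc' hc' ic' cc' oc'] hh'.
have E (t : config T -> nat -> bool) n :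
    limsup1 l (fun b => t (h b) n) <-> limsup1 l (fun b => t (h' b) n).
  by split=> H b /H [g [gl bg tg]]; exists g; split=> //; [rewrite -hh'|rewrite hh'].
apply: config_eq; rewrite ?sc ?sc' ?hc ?hc' // => n.
- by rewrite ic E ic'.
- by rewrite cc E cc'.
- by rewrite oc E oc'.
Qed.

(** Together with [run_at_run] this replaces the existentially quantified run of [halts_at] by one
    fixed function. *)
Lemma run_unique x h a : is_run x h -> ordinal_set a -> h a = run_at T x a.
Proof.
move=> [hv h0 hs hl]; have [rv r0 rs rl] := run_at_run x.
elim/vin_ind: a => a IH oa; case: (ordinal_cases oa) => [ae|[b ba ae]|la].
- by rewrite (hv _ _ ae) (rv _ _ ae) h0 r0.
- have ob := ordinal_in oa ba.
  by rewrite (hv _ _ ae) (rv _ _ ae) hs // rs // IH.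
- apply: limit_config_eq (hl _ la) (rl _ la) _ => b ba.
  by apply: IH => //; apply: ordinal_in ba.
Qed.

Definition halts_first x a : Prop :=
  [/\ ordinal_set a, cstate (run_at T x a) = q_halt T &
    forall b, vin b a -> cstate (run_at T x b) <> q_halt T].

Lemma halts_atP x a c : halts_at x a c <-> halts_first x a /\ c = run_at T x a.
Proof.
split=> [[oa [h [hr ha hc hb]]]|[[oa ha hb] ->]].
  have ca : c = run_at T x a by rewrite -ha (run_unique hr).
  split=> //; split=> // [|b ba]; first by rewrite -ca.
  by rewrite -(run_unique hr); [apply: hb|apply: ordinal_in ba].
by split=> //; exists (run_at T x); split=> //; apply: run_at_run.
Qed.

Lemma halts_first_unique x a b : halts_first x a -> halts_first x b -> veq a b.
Proof.
move=> [oa ha na] [ob hb nb].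
by case: (ordinal_trichotomy oa ob) => // [/nb|/na].
Qed.

Lemma accepts_first x a : halts_first x a ->
  accepts T x <-> coutput (run_at T x a) 0.
Proof.
move=> fa; split=> [[b [c [/halts_atP [fb ->]]]]|oa].
  by rewrite (run_at_veq _ (halts_first_unique fb fa)).
by exists a, (run_at T x a); split=> //; apply/halts_atP.
Qed.

Lemma run_nat x n : run_at T x (vnat n) = iter n (@step T) (init_config T x).
Proof.
have [_ r0 rs _] := run_at_run x.
by elim: n => // n IH; rewrite iterS -IH; apply: rs; apply: ordinal_nat.
Qed.

Lemma limsup_omega x (t : config T -> nat -> bool) n :
  limsup1 vomega (fun b => t (run_at T x b) n) <->
  forall m, exists2 k, m <= k & t (iter k (@step T) (init_config T x)) n.
Proof.
have le m k : vsub (vnat m) (vnat k) <-> m <= k.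
  split=> [mk|mk w /vin_nat [i im wi]].
    rewrite leqNgt; apply/negP => km.
    have /mk/vin_nat [i ik /vnat_inj ki] : vin (vnat k) (vnat m) by apply/vin_nat; exists k.
    by rewrite -ki ltnn in ik.
  by apply/vin_nat; exists i => //; apply: leq_trans im mk.
split=> [H m|H b /vin_omega [m bm]].
- have [|b [/vin_omega [k bk] mb tb]] := H (vnat m); first by exists m.
  exists k; first by apply/le; rewrite -bk.
  by rewrite -run_nat -(run_at_veq x bk).
- have [k mk tk] := H m; exists (vnat k); split; first by exists k.
    by rewrite bm; apply/le.
  by rewrite run_nat.
Qed.

End Runs.

(* Such a machine decides at stage omega: it accepts iff cell 0 of the input
   tape is 1 at infinitely many finite stages. *)
Record buchi_machine (T : ittm) : Prop := {
  buchi_limit : forall b, program (q_limit T) b = (q_halt T, (b.1.1, b.1.2, b.1.1), MoveRight);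
  buchi_halt : forall x n, cstate (iter n (@step T) (init_config T x)) <> q_halt T
}.

(** An admissible ordinal above omega is a limit: if it were [vsucc b], pairing would give a set in
    L_(b+1)[x] with L_b[x] as an element, but such a set is a subset of L_b[x]. *)
Lemma omega1_succ_omega x w : is_omega1 x w -> vin (vsucc vomega) w.
Proof.
move=> [[ow kp] omw wmin].
have [[w0 _] _] := (omw, ow).
case: (ordinal_cases ow) => [we|[b bw we]|[_ _]]; last exact.
- by move: omw; rewrite we => /vin_empty.
- case: (vin_irrefl (u := Lrel x b)); have ob := ordinal_in ow bw.
  have bL : vin (Lrel x b) (Lrel x w) by apply: Lrel_in.
  have [c [cL bc _]] := KP_pairing kp bL bL.
  have /vin_Lrel [d dw /vsub_Def cd] := cL.
  move: bc => /cd; apply: Lrel_mono; move: dw; rewrite we => /vin_succ [|->//].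
  exact: (proj1 ob).
Qed.

(** At stage omega the bit in cell 0 is the limsup over the finite stages. The limit state copies it
    to the output tape while entering the halt state. *)
Lemma buchi_accepts (T : ittm) x : buchi_machine T ->
  halts_first T x (vsucc vomega) /\
  (accepts T x <-> forall m, exists2 k, m <= k &
     cinput (iter k (@step T) (init_config T x)) 0).
Proof.
move=> [bl bh]; have [_ _ rs rl] := run_at_run T x.
have [qw hw iw _ _] := rl _ limit_omega.
have Sw := rs _ ordinal_omega.
have first : halts_first T x (vsucc vomega).
  split; first exact: ordinal_succ ordinal_omega.
    by rewrite Sw /step qw bl.
  move=> b /vin_succ [/vin_omega [n bn]|bw].
    by rewrite (run_at_veq T x bn) run_nat; apply: bh.
  rewrite (run_at_veq T x bw) qw => E.
  by have := special_states_distinct T; rewrite E /= !inE eqxx andbF.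
split=> //; rewrite (accepts_first first) Sw /step qw bl /= hw /write /=.
by rewrite iw (limsup_omega x (@cinput T)).
Qed.

Lemma buchi_NPplus (T : ittm) : buchi_machine T ->
  NPplus [set x | exists y, accepts T (interleave x y)]%classic.
Proof.
move=> bT; exists T; split=> // x y; have [w [iw ow wmin] _] := omega1_exists x.
exists w => //; exists (vsucc vomega), (run_at T (interleave x y) (vsucc vomega)).
split; last exact: omega1_succ_omega (And3 iw ow wmin).
by apply/halts_atP; split=> //; case: (buchi_accepts (interleave x y) bT).
Qed.

(** * Pseudo-hierarchies *)

Section Collapse.
Variable E : nat -> nat -> Prop.

(** Mostowski collapse of the accessible part of [E]. It is defined on accessibility proofs because
    [E] may be ill-founded; [collapse] takes the default value [vempty] elsewhere. *)
Fixpoint collapse_acc u (a : Acc E u) : V :=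
  VSet (fun s : {w | E w u} => collapse_acc (Acc_inv a (proj2_sig s))).

Definition collapse u : V := if pselect (Acc E u) is left a then collapse_acc a else vempty.

Lemma collapseE u (a : Acc E u) : collapse u = collapse_acc a.
Proof.
rewrite /collapse; case: pselect => // a'.
by congr collapse_acc; apply: Prop_irrelevance.
Qed.

Lemma vin_collapse u v : Acc E u ->
  vin v (collapse u) <-> exists2 w, E w u & veq v (collapse w).
Proof.
move=> au; rewrite (collapseE au); case: au => H.
split=> [[[w Ewu] /= vw]|[w Ewu]].
  by exists w => //; rewrite (collapseE (H w Ewu)); exact: vw.
rewrite (collapseE (H w Ewu)) => vw; exists (exist _ w Ewu); exact: vw.
Qed.

End Collapse.

(** Numbers name both stages and sets: [plt] orders stages, [pmem] is membership between sets,
    [plev u b] places the set [u] in the level [b], and [pwit] is the guessed real. Names may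
    repeat, so [plt] will only be a weak order, and equality of sets is the extensional [peq]. *)
Record pstruct (T : ittm) := PStruct {
  plt : nat -> nat -> bool;
  pmem : nat -> nat -> bool;
  plev : nat -> nat -> bool;
  pcfg : nat -> config T;
  pwit : nat -> bool
}.

Section Pseudo.
Variables (T : ittm) (x : nat -> bool) (s : pstruct T).
Local Notation "a <<< b" := (plt s a b) (at level 70).
Local Notation "u =: v" := (pmem s u v) (at level 70).
Local Notation "u @@ b" := (plev s u b) (at level 70).

Definition peq u w : Prop := forall t, t =: u <-> t =: w.

Fixpoint pnat k u : Prop :=
  if k is k'.+1 then
    exists v, pnat k' v /\ forall w, w =: u <-> w =: v \/ peq w v
  else forall w, ~ w =: u.

Definition pcover b c : Prop := b <<< c /\ forall d, b <<< d -> ~ d <<< c.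

Fixpoint pfin k b : Prop :=
  if k is k'.+1 then exists c, pcover c b /\ pfin k' c else forall c, ~ c <<< b.

Definition psat c n (p : form n) (e : 'I_n -> nat) : Prop :=
  gsat (pmem s) peq (fun u => exists k, x k /\ pnat k u) (plev s ^~ c) p e.

Definition pdefines c n (p : form n.+1) (e : 'I_n -> nat) u : Prop :=
  forall w, w =: u <-> w @@ c /\ psat c p (gcons w e).

(** The level [c] already contains the witnesses for an instance of collection. Truth is evaluated
    in [c] itself, which for a bounded [p] agrees with the larger levels. *)
Definition pcollects n (p : form n.+2) a (e : 'I_n -> nat) c : Prop :=
  [/\ a @@ c, forall i, e i @@ c & forall u, u @@ c -> u =: a ->
    exists v, v @@ c /\ psat c p (gcons v (gcons u e))].

Definition plimsup (t : config T -> nat -> bool) b n : Prop :=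
  forall c, c <<< b -> exists d, [/\ d <<< b, ~ d <<< c & t (pcfg s d) n].

Definition phalts b : Prop :=
  cstate (pcfg s b) = q_halt T /\ forall c, c <<< b -> cstate (pcfg s c) <> q_halt T.

(* Everything here is first-order over the natural numbers.  The order [plt] may
   be ill-founded; the last clause of [pseudo_levels] is the only trace of
   well-foundedness. *)
Definition pseudo_order : Prop := [/\
  forall a b c, a <<< b -> b <<< c -> a <<< c,
  forall a b c, a <<< c -> a <<< b \/ b <<< c,
  forall a b, a <<< b -> exists c, pcover a c &
  exists b, (forall c, c <<< b -> exists k, pfin k c) /\
    (forall k, exists c, c <<< b /\ pfin k c)].

Definition pseudo_levels : Prop := [/\
  forall u w v, peq u w -> w =: v -> u =: v,
  forall u b, u @@ b <-> exists c, c <<< b /\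
    exists n (p : form n.+1) e, (forall i, e i @@ c) /\ pdefines c p e u,
  forall c n (p : form n.+1) e, (forall i, e i @@ c) -> exists u, pdefines c p e u &
  forall n (p : form n.+2) a e c, pcollects p a e c ->
    exists d, pcollects p a e d /\ forall d', d' <<< d -> ~ pcollects p a e d'].

Definition pseudo_run : Prop := [/\
  forall b, (forall c, ~ c <<< b) ->
    pcfg s b = init_config T (interleave x (pwit s)),
  forall b c, pcover c b -> pcfg s b = step (pcfg s c),
  forall b, (exists c, c <<< b) ->
    (forall c, c <<< b -> exists d, d <<< b /\ c <<< d) ->
    [/\ cstate (pcfg s b) = q_limit T, chead (pcfg s b) = 0,
      forall n, cinput (pcfg s b) n <-> plimsup (@cinput T) b n,
      forall n, cscratch (pcfg s b) n <-> plimsup (@cscratch T) b n &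
      forall n, coutput (pcfg s b) n <-> plimsup (@coutput T) b n] &
  exists b, phalts b /\ coutput (pcfg s b) 0].

Definition pseudo : Prop := [/\ pseudo_order, pseudo_levels & pseudo_run].

Hypothesis ps : pseudo.

Let ps_trans := let: And3 (And4 H _ _ _) _ _ := ps in H.
Let ps_total := let: And3 (And4 _ H _ _) _ _ := ps in H.
Let ps_cover := let: And3 (And4 _ _ H _) _ _ := ps in H.
Let ps_omega := let: And3 (And4 _ _ _ H) _ _ := ps in H.
Let ps_ext := let: And3 _ (And4 H _ _ _) _ := ps in H.
Let ps_lev := let: And3 _ (And4 _ H _ _) _ := ps in H.
Let ps_comp := let: And3 _ (And4 _ _ H _) _ := ps in H.
Let ps_ind := let: And3 _ (And4 _ _ _ H) _ := ps in H.
Let ps_run0 := let: And3 _ _ (And4 H _ _ _) := ps in H.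
Let ps_runS := let: And3 _ _ (And4 _ H _ _) := ps in H.
Let ps_runL := let: And3 _ _ (And4 _ _ H _) := ps in H.
Let ps_halt := let: And3 _ _ (And4 _ _ _ H) := ps in H.

Let wf := Acc (fun a b => a <<< b).
Let mwf := Acc (fun a b => a =: b).
Let o := collapse (fun a b => a <<< b).
Let j := collapse (fun a b => a =: b).

Lemma wf_lt b c : wf b -> c <<< b -> wf c.
Proof. by case=> H /H. Qed.

Lemma vin_o b v : wf b -> vin v (o b) <-> exists2 c, c <<< b & veq v (o c).
Proof. exact: vin_collapse. Qed.

Lemma vin_j u v : mwf u -> vin v (j u) <-> exists2 w, w =: u & veq v (j w).
Proof. exact: vin_collapse. Qed.

Lemma ordinal_o b : wf b -> ordinal_set (o b).
Proof.
elim=> {}b H IH; have wb : wf b by apply: Acc_intro.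
split=> [u /(vin_o _ wb) [c cb uc] v|u /(vin_o _ wb) [c cb ->]]; last by case: (IH c cb).
rewrite uc => /(vin_o _ (H c cb)) [d dc vd]; apply/(vin_o _ wb); exists d => //.
exact: (ps_trans dc cb).
Qed.

Lemma o_lt b c : wf b -> wf c -> b <<< c <-> vin (o b) (o c).
Proof.
move=> wb wc; split=> [bc|/(vin_o _ wc) [d dc bd]]; first by apply/(vin_o _ wc); exists b.
have [|//] := ps_total b dc => db.
have : vin (o d) (o b) by apply/(vin_o _ wb); exists d.
by rewrite bd => /vin_irrefl.
Qed.

(** Otherwise the weak order would put every predecessor of [c] below [b], and [c] would be
    well-founded. *)
Lemma wf_initial b c : wf b -> ~ wf c -> b <<< c.
Proof.
move=> wb nc; apply: contrapT => bc; apply: nc; apply: Acc_intro => d dc.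
by have [/(wf_lt wb)|//] := ps_total b dc.
Qed.

Lemma nwf_lower b : ~ wf b -> exists2 c, c <<< b & ~ wf c.
Proof.
move=> nb; apply: contrapT => H; apply: nb; apply: Acc_intro => c cb.
by apply: contrapT => nc; apply: H; exists c.
Qed.

(** An ill-founded [c] has an ill-founded predecessor, which lies above [b] and hence strictly
    between the two. *)
Lemma wf_cover b c : wf b -> pcover b c -> wf c.
Proof.
move=> wb [bc H]; apply: contrapT => /nwf_lower [d dc nd].
by apply: (H d) dc; apply: wf_initial.
Qed.

Lemma o_cover b c : wf c -> pcover b c -> veq (o c) (vsucc (o b)).
Proof.
move=> wc [bc H]; have wb := wf_lt wc bc; apply: succ_eqP.
- exact: ordinal_o.
- exact/o_lt.
- move=> v /(vin_o _ wc) [d dc ->] /(o_lt wb (wf_lt wc dc)) bd.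
  exact: H bd dc.
Qed.

Lemma pfin_nat k b : pfin k b -> wf b /\ veq (o b) (vnat k).
Proof.
elim: k b => [|k IH] b /=.
  move=> H; have wb : wf b by apply: Acc_intro => c /H.
  by split=> //; apply: vemptyP => v /(vin_o _ wb) [c /H].
move=> [c [cb /IH [wc ck]]]; have wb := wf_cover wc cb; split=> //.
by rewrite (o_cover wb cb) ck.
Qed.

(** The last clause of [pseudo_order] puts a true copy of omega into the well-founded part;
    [is_omega1] compares only with admissible ordinals above omega. *)
Lemma wf_omega : exists2 b, wf b & veq (o b) vomega.
Proof.
have [b [bfin finb]] := ps_omega.
have wb : wf b by apply: Acc_intro => c /bfin [k /pfin_nat []].
exists b => //; apply/veqP => v; rewrite (vin_o _ wb) vin_omega; split.
- by move=> [c /bfin [k /pfin_nat [_ ck]] vc]; exists k; rewrite vc.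
- move=> [k vk]; have [c [cb /pfin_nat [_ ck]]] := finb k.
  by exists c => //; rewrite vk ck.
Qed.

(** * The collapse of the well-founded levels *)

Lemma lev_mem b u w : u @@ b -> w =: u -> exists2 c, c <<< b & w @@ c.
Proof. by move=> /ps_lev [c [cb [n [p [e [_ H]]]]]] /H [wc _]; exists c. Qed.

Lemma lev_mono b c u : b <<< c -> u @@ b -> u @@ c.
Proof.
move=> bc /ps_lev [d [db H]]; apply/ps_lev; exists d; split=> //.
exact: (ps_trans db bc).
Qed.

Lemma lev_trans b u w : u @@ b -> w =: u -> w @@ b.
Proof. by move=> ub /(lev_mem ub) [c cb]; apply: lev_mono. Qed.

Lemma mwf_lev b u : wf b -> u @@ b -> mwf u.
Proof.
move=> wb; elim: wb u => {}b _ IH u ub; apply: Acc_intro => w /(lev_mem ub) [c cb].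
exact: IH.
Qed.

Lemma mwf_mem u w : mwf u -> w =: u -> mwf w.
Proof. by case=> H /H. Qed.

Lemma j_inj u w : mwf u -> mwf w -> veq (j u) (j w) -> peq u w.
Proof.
move=> mu; elim: mu w => {}u mu IH w mw uw t.
have mu' : mwf u by apply: Acc_intro.
split=> [tu|tw].
- have : vin (j t) (j w) by rewrite -uw; apply/(vin_j _ mu'); exists t.
  move=> /(vin_j _ mw) [r rw tr].
  apply: (ps_ext _ rw); exact: (IH t tu r (mwf_mem mw rw) tr).
- have : vin (j t) (j u) by rewrite uw; apply/(vin_j _ mw); exists t.
  move=> /(vin_j _ mu') [r ru tr].
  have rt : peq r t by apply: (IH r ru t (mwf_mem mw tw)); symmetry.
  by apply: (ps_ext _ ru) => q; rewrite (rt q).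
Qed.

Lemma j_peq u w : mwf u -> mwf w -> peq u w <-> veq (j u) (j w).
Proof.
move=> mu mw; split=> [uw|]; last exact: j_inj.
by apply/veqP => v; rewrite (vin_j _ mu) (vin_j _ mw); split=> -[t /uw tw vt]; exists t.
Qed.

Lemma j_mem u w : mwf u -> mwf w -> u =: w <-> vin (j u) (j w).
Proof.
move=> mu mw; split=> [uw|]; first by apply/(vin_j _ mw); exists u.
move=> /(vin_j _ mw) [t tw ut]; apply: (ps_ext _ tw).
exact/(j_peq mu (mwf_mem mw tw)).
Qed.

Lemma j_nat k u : mwf u -> pnat k u <-> veq (j u) (vnat k).
Proof.
elim: k u => [|k IH] u mu /=.
  split=> [H|u0 w wu]; first by apply: vemptyP => v /(vin_j _ mu) [w /H].
  by apply: (@vin_empty (j w)); rewrite -u0; exact/(j_mem (mwf_mem mu wu) mu).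
split=> [[v [vk vE]]|uk].
- have vu : v =: u by apply/vE; right.
  have mv := mwf_mem mu vu; have {}vk := proj1 (IH v mv) vk.
  apply/veqP => w; rewrite (vin_j _ mu) vin_succ -vk (vin_j _ mv); split.
  + move=> [t tu wt]; have mt := mwf_mem mu tu.
    case/vE: tu => [tv|tv]; first by left; exists t.
    by right; rewrite wt; exact/(j_peq mt mv).
  + move=> [[t tv wt]|wv]; last by exists v.
    by exists t => //; apply/vE; left.
- have : vin (vnat k) (j u) by rewrite uk; apply: vin_succ_diag.
  move=> /(vin_j _ mu) [v vu kv]; have mv := mwf_mem mu vu.
  exists v; split; first by apply/IH => //; symmetry.
  move=> w; split=> [wu|].
  + have mw := mwf_mem mu wu; have : vin (j w) (j u) by exact/(j_mem mw mu).
    rewrite uk vin_succ kv => -[H|H]; [left|right].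
      exact/(j_mem mw mv).
    exact/(j_peq mw mv).
  + move=> [wv|wv].
      have mw := mwf_mem mv wv; apply/(j_mem mw mu); rewrite uk; apply/vin_succ; left.
      by rewrite kv; exact/(j_mem mw mv).
    exact: (ps_ext wv vu).
Qed.

Definition level_iso b : Prop :=
  forall v, vin v (Lrel x (o b)) <-> exists2 u, u @@ b & veq v (j u).

Lemma psat_iso c n (p : form n) e e' : wf c -> level_iso c ->
  (forall i, e i @@ c) -> (forall i, veq (e' i) (j (e i))) ->
  psat c p e <-> sat x (Lrel x (o c)) p e'.
Proof.
move=> wc iso ec ee'; rewrite sat_gsat.
have m u : u @@ c -> mwf u by apply: mwf_lev.
apply: (gsat_rel (S := fun u v => veq v (j u))) => //.
- by move=> u uc; exists (j u) => //; apply/iso; exists u.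
- by move=> v /iso [u uc vu]; exists u.
- by move=> u v u' v' uc vc _ _ -> ->; apply: j_mem; apply: m.
- by move=> u v u' v' uc vc _ _ -> ->; apply: j_peq; apply: m.
- move=> u u' uc _ uu'; split=> [[k [xk uk]]|[k xk uk]]; exists k => //.
  + by rewrite uu'; apply/(j_nat _ (m u uc)).
  + by split=> //; apply/(j_nat _ (m u uc)); rewrite -uu'.
- by move=> i; apply/iso; exists (e i).
Qed.

(** Induction along the order: level [b] consists of the sets definable over lower levels,
    definability transfers by [psat_iso], and the comprehension clause names every definable set, so
    that the collapse misses none. *)
Lemma level_isoP b : wf b -> level_iso b.
Proof.
elim=> {}b H IH v; have wb : wf b by apply: Acc_intro.
have psatE c n (p : form n.+1) e e' w w' : c <<< b ->
    (forall i, e i @@ c) -> (forall i, veq (e' i) (j (e i))) -> w @@ c -> veq w' (j w) ->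
    psat c p (gcons w e) <-> sat x (Lrel x (o c)) p (econs w' e').
  move=> cb ec ee' wc ww'; apply: psat_iso; [exact: H|exact: IH|..].
  - exact: (gcons_pred (D := fun u => u @@ c)).
  - by move=> i; rewrite /econs /gcons; case: unliftP.
rewrite vin_Lrel; split.
- move=> [b' /(vin_o _ wb) [c cb ->] /vin_Def [n [p [e' [e'c vE]]]]].
  have /choice [e eP] : forall i, exists u, u @@ c /\ veq (e' i) (j u).
    by move=> i; have /(IH c cb) [u uc eu] := e'c i; exists u.
  have ec i : e i @@ c by case: (eP i).
  have ee' i : veq (e' i) (j (e i)) by case: (eP i).
  have [u uE] := ps_comp p ec.
  have ub : u @@ b by apply/ps_lev; exists c; split=> //; exists n, p, e.
  exists u => //; apply/veqP => w; rewrite vE (vin_j _ (mwf_lev wb ub)); split.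
  + move=> [/(IH c cb) [t tc wt] st]; exists t => //; apply/uE; split=> //.
    exact/(psatE _ _ _ _ _ _ _ cb ec ee' tc wt).
  + move=> [t /uE [tc st] wt]; split; first by apply/(IH c cb); exists t.
    exact/(psatE _ _ _ _ _ _ _ cb ec ee' tc wt).
- move=> [u ub vu]; rewrite /level_iso in IH.
  have /ps_lev [c [cb [n [p [e [ec uE]]]]]] := ub.
  exists (o c); first by apply/(vin_o _ wb); exists c.
  apply/vin_Def; exists n, p, (fun i => j (e i)); split=> [i|w].
    by apply/(IH c cb); exists (e i).
  rewrite vu (vin_j _ (mwf_lev wb ub)); split.
  + move=> [t /uE [tc st] wt]; split; first by apply/(IH c cb); exists t.
    exact/(psatE _ _ _ _ _ _ _ cb ec (fun i => veq_refl _) tc wt).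
  + move=> [/(IH c cb) [t tc wt] st]; exists t => //; apply/uE; split=> //.
    exact/(psatE _ _ _ _ _ _ _ cb ec (fun i => veq_refl _) tc wt).
Qed.

Definition wfp : V := VSet (fun b : {b | wf b} => o (sval b)).

Lemma vin_wfp v : vin v wfp <-> exists2 b, wf b & veq v (o b).
Proof. by split=> [[[b wb] vb]|[b wb vb]]; [exists b|exists (exist _ b wb)]. Qed.

Lemma ordinal_wfp : ordinal_set wfp.
Proof.
split=> [u /vin_wfp [b wb ub] v|u /vin_wfp [b wb ->]]; last by case: (ordinal_o wb).
rewrite ub => /(vin_o _ wb) [c cb vc]; apply/vin_wfp; exists c; last exact: vc.
exact: (wf_lt wb cb).
Qed.

Lemma omega_wfp : vin vomega wfp.
Proof. by have [b wb bw] := wf_omega; apply/vin_wfp; exists b => //; symmetry. Qed.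

(** * Overspill in an ill-founded structure *)

Section IllFounded.
Variable b0 : nat.
Hypothesis nb0 : ~ wf b0.

Lemma wf_next b : wf b -> exists2 c, wf c & b <<< c.
Proof.
move=> wb; have [c bc] := ps_cover (wf_initial wb nb0).
by exists c; [exact: (wf_cover wb bc)|case: bc].
Qed.

Lemma limit_wfp : limit_ordinal wfp.
Proof.
apply/(limit_ordinalP ordinal_wfp); split; first by exists vomega; apply: omega_wfp.
move=> v /vin_wfp [b wb vb]; have [c wc bc] := wf_next wb.
by exists (o c); [apply/vin_wfp; exists c|rewrite vb; apply/o_lt].
Qed.

Lemma vin_Lwfp v : vin v (Lrel x wfp) <-> exists2 b, wf b & vin v (Lrel x (o b)).
Proof.
split=> [/vin_Lrel [u /vin_wfp [b wb ub] vu]|[b wb]].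
- have [c wc bc] := wf_next wb; exists c => //; apply/vin_Lrel; exists u => //.
  by rewrite ub; apply/o_lt.
- by apply: Lrel_mono; apply: (proj1 ordinal_wfp); apply/vin_wfp; exists b.
Qed.

Lemma wf_max2 b c : wf b -> wf c -> exists d, [/\ wf d, b <<< d & c <<< d].
Proof.
move=> wb wc; have [d wd bd] := wf_next wb.
have [bc|cd] := ps_total c bd; last by exists d.
have [e we ce] := wf_next wc; exists e; split=> //; exact: (ps_trans bc ce).
Qed.

Lemma wf_max n (c : 'I_n -> nat) : (forall i, wf (c i)) ->
  exists2 d, wf d & forall i, c i <<< d.
Proof.
elim: n c => [|n IH] c wc; first by have [b wb _] := wf_omega; exists b => // -[].
have [d wd cd] := IH (fun i => c (lift ord0 i)) (fun i => wc _).
have [e [we de ce]] := wf_max2 wd (wc ord0); exists e => // i.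
have [k ->|->//] := unliftP ord0 i.
exact: (ps_trans (cd k) de).
Qed.

Lemma psat_delta0 b c n (p : form n) e : b <<< c -> delta0 p ->
  (forall i, e i @@ b) -> psat b p e <-> psat c p e.
Proof.
move=> bc dp eb; apply: gsat_delta0 => // [u|u w ub _].
- exact: lev_mono.
- exact: lev_trans.
Qed.

(* If collection failed, then "collection holds below [c]" would single out the
   ill-founded [c], which have no least element. *)
Lemma admissible_wfp : admissible x wfp.
Proof.
split; first exact: ordinal_wfp.
apply: (Lrel_KP limit_wfp) => n p e' dp e'L d dL dv.
have trL : vtransitive (Lrel x wfp) by apply: Lrel_trans; case: ordinal_wfp.
have iso b : wf b -> level_iso b by apply: level_isoP.
have /choice [ce ceP] : forall i, exists cu : nat * nat,
    [/\ wf cu.1, cu.2 @@ cu.1 & veq (e' i) (j cu.2)].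
  move=> i; have /vin_Lwfp [c wc /(iso c wc) [u uc eu]] := e'L i.
  by exists (c, u).
have /vin_Lwfp [c1 wc1 /(iso c1 wc1) [a ac1 da]] := dL.
have [c2 wc2 lec2] : exists2 c2, wf c2 & forall i, (ce i).1 <<< c2.
  by apply: wf_max => i; case: (ceP i).
(* All parameters get names in one common well-founded level [c3]. *)
have [c3 [wc3 c13 c23]] := wf_max2 wc1 wc2.
pose e i := (ce i).2.
have ec3 i : e i @@ c3.
  by have [_ H _] := ceP i; exact: (lev_mono c23 (lev_mono (lec2 i) H)).
have ac3 : a @@ c3 := lev_mono c13 ac1.
have ee' i : veq (e' i) (j (e i)) by case: (ceP i).
have inL b u : wf b -> u @@ b -> vin (j u) (Lrel x wfp).
  by move=> wb ub; apply/vin_Lwfp; exists b => //; apply/iso => //; exists u.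
have mwfP b u : wf b -> u @@ b -> mwf u by apply: mwf_lev.
have satE b v u v' u' : wf b -> (forall i, e i @@ b) -> v @@ b -> u @@ b ->
    veq v' (j v) -> veq u' (j u) ->
    psat b p (gcons v (gcons u e)) <-> sat x (Lrel x wfp) p (econs v' (econs u' e')).
  move=> wb eb vb ub vv' uu'.
  have -> : sat x (Lrel x wfp) p (econs v' (econs u' e')) <->
            sat x (Lrel x (o b)) p (econs v' (econs u' e')).
    symmetry; apply: sat_delta0 => //.
    - by move=> w wb'; apply/vin_Lwfp; exists b.
    - by apply: Lrel_trans; case: (ordinal_o wb).
    - apply: (gcons_pred (D := vin^~ _)); first by apply/(iso b wb); exists v.
      apply: (gcons_pred (D := vin^~ _)); first by apply/(iso b wb); exists u.
      by move=> i; apply/(iso b wb); exists (e i).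
  apply: psat_iso => //; first exact: iso.
  - by apply: (gcons_pred (D := fun w => w @@ b)) => //; apply: (gcons_pred (D := fun w => w @@ b)).
  - move=> i; rewrite /econs /gcons; case: unliftP => // k _; rewrite /econs /gcons.
    by case: unliftP.
(* Every ill-founded level collects: each witness lies in some well-founded level [c5], hence below
   [c], and a bounded formula keeps its truth value from [c5] to [c]. *)
have nwf_coll c : ~ wf c -> pcollects p a e c.
  move=> nc; have c3c := wf_initial wc3 nc.
  split=> [|i|u _ ua]; [exact: (lev_mono c3c ac3)|exact: (lev_mono c3c (ec3 i))|].
  have uc3 : u @@ c3 := lev_trans ac3 ua.
  have [||v' v'L sv'] := dv (j u).
  - exact: (inL c3).
  - by rewrite da; exact/(j_mem (mwfP c3 u wc3 uc3) (mwfP c3 a wc3 ac3)).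
  - have /vin_Lwfp [c4 wc4 /(iso c4 wc4) [v vc4 vv']] := v'L.
    have [c5 [wc5 c35 c45]] := wf_max2 wc3 wc4.
    have ec5 i : e i @@ c5 := lev_mono c35 (ec3 i).
    have uc5 := lev_mono c35 uc3; have vc5 := lev_mono c45 vc4.
    have c5c := wf_initial wc5 nc; exists v; split; first exact: (lev_mono c5c vc5).
    apply/(psat_delta0 c5c) => //; last by apply/(satE _ _ _ v' (j u)).
    by apply: (gcons_pred (D := fun w => w @@ c5)) => //; apply: (gcons_pred (D := fun w => w @@ c5)).
(* The least collecting level is well-founded, because an ill-founded one has an ill-founded level
   below it that collects too. It is therefore a bound inside [wfp]. *)
have [c [cc cmin]] := ps_ind (nwf_coll _ nb0).
have wc : wf c.
  by apply: contrapT => /nwf_lower [c' c'c /nwf_coll]; apply: cmin.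
have [ac ec cv] := cc.
exists (o c); first by apply/vin_wfp; exists c.
move=> u' u'L; rewrite da => /vin_j - /(_ (mwfP _ _ wc ac)) [u ua uu'].
have uc := lev_trans ac ua; have [v [vc sv]] := cv u uc ua.
exists (j v); first by apply/iso => //; exists v.
exact/(satE c v u (j v) u').
Qed.

Lemma omega1_sub_wfp w : is_omega1 x w -> vsub w wfp.
Proof. by move=> [_ _ wmin]; apply: wmin; [apply: admissible_wfp|apply: omega_wfp]. Qed.

End IllFounded.
(** On the well-founded part the local clauses of [pseudo_run] are the recursion equations of a run;
    [~ d <<< c] in [plimsup] collapses to the inclusion of the ordinal of [c] in that of [d]. *)
Lemma pcfg_run b : wf b -> pcfg s b = run_at T (interleave x (pwit s)) (o b).
Proof.
elim=> {}b H IH; have wb : wf b by apply: Acc_intro.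
have [rv r0 rs rl] := run_at_run T (interleave x (pwit s)).
have [[c cb]|nb] := pselect (exists c, c <<< b); last first.
  rewrite ps_run0 => [|c cb]; last by apply: nb; exists c.
  rewrite -r0; apply: rv; symmetry; apply: vemptyP => v /(vin_o _ wb) [c cb _].
  by apply: nb; exists c.
have [lim|] := pselect (forall c, c <<< b -> exists d, d <<< b /\ c <<< d).
- have lb : limit_ordinal (o b).
    apply/(limit_ordinalP (ordinal_o wb)); split.
      by exists (o c); apply/(vin_o _ wb); exists c.
    move=> v /(vin_o _ wb) [d db vd]; have [d' [d'b dd']] := lim d db.
    exists (o d'); first by apply/(vin_o _ wb); exists d'.
    by rewrite vd; exact/(o_lt (wf_lt wb db) (wf_lt wb d'b)).
  have [qb hb ib cb' ob] := ps_runL (ex_intro _ c cb) lim.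
  have [qb' hb' ib' cb'' ob'] := rl _ lb.
  have E (t : config T -> nat -> bool) n : plimsup t b n <->
      limsup1 (o b) (fun v => t (run_at T (interleave x (pwit s)) v) n).
    split=> L.
    - move=> v /(vin_o _ wb) [d db vd]; have [d' [d'b dd' td']] := L d db.
      exists (o d'); split; [by apply/(vin_o _ wb); exists d'| |by rewrite -IH].
      have [wd wd'] := (wf_lt wb db, wf_lt wb d'b).
      rewrite vd; apply/ordinal_sub; [exact: ordinal_o..|].
      by move=> /o_lt - /(_ wd' wd).
    - move=> d db; have [|v [/(vin_o _ wb) [d' d'b vd'] dv tv]] := L (o d).
        by apply/(vin_o _ wb); exists d.
      have [wd wd'] := (wf_lt wb db, wf_lt wb d'b).
      exists d'; split=> // [d'd|]; last by rewrite IH // -(rv _ _ vd').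
      move: dv; rewrite vd' => /ordinal_sub - /(_ (ordinal_o wd) (ordinal_o wd')); apply.
      exact/o_lt.
  apply: config_eq; rewrite ?qb ?hb ?qb' ?hb' // => n.
  - by rewrite ib E ib'.
  - by rewrite cb' E cb''.
  - by rewrite ob E ob'.
- move=> nlim; have [d db] : exists d, pcover d b.
    apply: contrapT => K; apply: nlim => d db; apply: contrapT => K'; apply: K.
    by exists d; split=> // d' dd' d'b; apply: K'; exists d'.
  have [d'b _] := db.
  rewrite (ps_runS db) (IH d d'b) (rv _ _ (o_cover wb db)) rs //.
  exact: (ordinal_o (wf_lt wb d'b)).
Qed.

(** If the recorded halting stage [b] is ill-founded, the true halting stage, being below
    [omega_1^x], has a well-founded name [d]. Then [d] precedes [b] and shows the halt state too
    early. *)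
Lemma pseudo_accepts w : is_omega1 x w ->
  halts_before T (interleave x (pwit s)) w -> accepts T (interleave x (pwit s)).
Proof.
move=> w1 [a [c [/halts_atP [[oa ha na] _] aw]]].
have [b [[hb minb] ob]] := ps_halt.
have [wb|nwb] := pselect (wf b).
- have first : halts_first T (interleave x (pwit s)) (o b).
    split; [exact: ordinal_o|by rewrite -pcfg_run|].
    move=> v /(vin_o _ wb) [d db vd]; rewrite (run_at_veq T _ vd) -pcfg_run.
      exact: minb.
    exact: (wf_lt wb db).
  by apply/(accepts_first first); rewrite -pcfg_run.
- have /vin_wfp [d wd ad] := omega1_sub_wfp nwb w1 aw.
  case: (minb d); first exact: wf_initial.
  by rewrite pcfg_run // -(run_at_veq T _ ad).
Qed.

End Pseudo.

Lemma enumerable_total A : enumerable (vin^~ A) -> (exists v, vin v A) ->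
  exists g : nat -> V, (forall n, vin (g n) A) /\
    forall v, vin v A -> exists n, veq v (g n).
Proof.
move=> [g gP] [v0 v0A].
exists (fun n => if `[< vin (g n) A >] then g n else v0); split=> [n|v vA].
  by case: ifP => [/asboolP|].
have [n vn] := gP v vA; exists n.
by have -> : `[< vin (g n) A >] by apply/asboolP; rewrite -vn.
Qed.

(** * The true hierarchy and run as a structure on the natural numbers *)

Section RealHierarchy.
Variables (T : ittm) (x y : nat -> bool) (a : V) (g0 g1 : nat -> V).
Hypothesis oa : ordinal_set a.
Hypothesis omega_a : vin vomega a.
Hypothesis g0_in : forall n, vin (g0 n) a.
Hypothesis g0_surj : forall v, vin v a -> exists n, veq v (g0 n).
Hypothesis g1_in : forall n, vin (g1 n) (Lrel x a).
Hypothesis g1_surj : forall v, vin v (Lrel x a) -> exists n, veq v (g1 n).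

Definition real_pstruct : pstruct T := {|
  plt b c := `[< vin (g0 b) (g0 c) >];
  pmem u w := `[< vin (g1 u) (g1 w) >];
  plev u b := `[< vin (g1 u) (Lrel x (g0 b)) >];
  pcfg b := run_at T (interleave x y) (g0 b);
  pwit := y
|}.
Let s := real_pstruct.

Lemma rltP b c : plt s b c <-> vin (g0 b) (g0 c).
Proof. by split=> /asboolP. Qed.

Lemma rmemP u w : pmem s u w <-> vin (g1 u) (g1 w).
Proof. by split=> /asboolP. Qed.

Lemma rlevP u b : plev s u b <-> vin (g1 u) (Lrel x (g0 b)).
Proof. by split=> /asboolP. Qed.

Let og b : ordinal_set (g0 b) := ordinal_in oa (g0_in b).

Lemma g0_down b v : vin v (g0 b) -> exists c, veq v (g0 c).
Proof. by move=> vb; apply: g0_surj; apply: (proj1 oa) (g0_in b) _ vb. Qed.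

Lemma g1_down u v : vin v (g1 u) -> exists w, veq v (g1 w).
Proof. by move=> vu; apply: g1_surj; apply: (Lrel_trans (proj1 oa)) (g1_in u) _ vu. Qed.

Lemma g1_lev c v : vin v (Lrel x (g0 c)) -> exists w, veq v (g1 w).
Proof. by move=> vc; apply: g1_surj; apply: Lrel_mono vc; apply: (proj1 oa). Qed.

Lemma rpeqP u w : peq s u w <-> veq (g1 u) (g1 w).
Proof.
split=> [uw|uw t]; last by rewrite !rmemP uw.
apply/veqP => v; split=> /[dup] /g1_down [t ->] /rmemP /uw /rmemP //.
Qed.

Lemma rpnatP k u : pnat s k u <-> veq (g1 u) (vnat k).
Proof.
elim: k u => [|k IH] u /=.
  split=> [H|u0 w]; last by rewrite rmemP u0 => /vin_empty.
  by apply: vemptyP => v /[dup] /g1_down [w ->] /rmemP /H.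
split=> [[v [/IH vk vE]]|uk].
- apply/veqP => w; rewrite vin_succ -vk; split=> [wu|wv].
  + have [t wt] := g1_down wu; move: wu; rewrite wt => /rmemP /vE [/rmemP|/rpeqP]; by [left|right].
  + have [t wt] : exists t, veq w (g1 t) by case: wv => [/g1_down|wv] //; exists v.
    rewrite wt; apply/rmemP/vE; rewrite wt in wv.
    by case: wv => [/rmemP|/rpeqP]; [left|right].
- have [v kv] : exists v, veq (vnat k) (g1 v).
    by apply: (@g1_down u); rewrite uk; apply: vin_succ_diag.
  exists v; split=> [|w]; first by apply/IH; symmetry.
  by rewrite !rmemP rpeqP uk vin_succ kv.
Qed.

Lemma rpsatP c n (p : form n) e e' : (forall i, plev s (e i) c) ->
  (forall i, veq (e' i) (g1 (e i))) -> psat x s c p e <-> sat x (Lrel x (g0 c)) p e'.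
Proof.
move=> ec ee'; rewrite sat_gsat; apply: (gsat_rel (S := fun u v => veq v (g1 u))) => //.
- by move=> u /rlevP uc; exists (g1 u).
- by move=> v /[dup] vc /g1_lev [u vu]; exists u => //; apply/rlevP; rewrite -vu.
- by move=> u v u' v' _ _ _ _ -> ->; rewrite rmemP.
- by move=> u v u' v' _ _ _ _ -> ->; rewrite rpeqP.
- move=> u u' _ _ uu'; split=> [[k [xk /rpnatP uk]]|[k xk uk]]; exists k => //.
    by rewrite uu'.
  by split=> //; apply/rpnatP; rewrite -uu'.
- by move=> i; rewrite ee'; apply/rlevP.
Qed.

Lemma rpdefinesP c n (p : form n.+1) e e' u : (forall i, plev s (e i) c) ->
  (forall i, veq (e' i) (g1 (e i))) ->
  pdefines x s c p e u <-> defines x (Lrel x (g0 c)) p e' (g1 u).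
Proof.
move=> ec ee'.
have psatE w w' : plev s w c -> veq w' (g1 w) ->
    psat x s c p (gcons w e) <-> sat x (Lrel x (g0 c)) p (econs w' e').
  move=> wc ww'; apply: rpsatP; first exact: (gcons_pred (D := plev s ^~ c)).
  by move=> i; rewrite /econs /gcons; case: unliftP.
have e'c i : vin (e' i) (Lrel x (g0 c)) by rewrite ee'; apply/rlevP.
split=> [H|[_ H] w].
- split=> // w; split=> [wu|[wc sw]].
  + have [t wt] := g1_down wu; have /rmemP /H [tc st] : vin (g1 t) (g1 u) by rewrite -wt.
    by split; [rewrite wt; apply/rlevP|apply/(psatE t)].
  + have [t wt] := g1_lev wc; rewrite wt; apply/rmemP/H.
    have tc : plev s t c by apply/rlevP; rewrite -wt.
    by split=> //; apply/(psatE t w).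
- rewrite rmemP H -rlevP; split=> -[wc sw]; split=> //; apply/(psatE w (g1 w)) => //.
Qed.

Lemma rpcover b c : pcover s b c <-> veq (g0 c) (vsucc (g0 b)).
Proof.
split=> [[/rltP bc H]|cb].
- apply: succ_eqP => // v vc bv; have [d vd] := g0_down vc.
  by apply: (H d); apply/rltP; rewrite -vd.
- split; first by apply/rltP; rewrite cb; apply: vin_succ_diag.
  by move=> d /rltP bd /rltP; rewrite cb; apply: ordinal_succ_le.
Qed.

Lemma rpfin k b : veq (g0 b) (vnat k) -> pfin s k b.
Proof.
elim: k b => [|k IH] b bk; first by move=> c /rltP; rewrite bk => /vin_empty.
have [c kc] : exists c, veq (vnat k) (g0 c).
  by apply: (@g0_down b); rewrite bk; apply: vin_succ_diag.
exists c; split; last by apply: IH; symmetry.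
by apply/rpcover; rewrite bk -kc.
Qed.

Lemma real_pseudo b0 : halts_first T (interleave x y) b0 -> vin b0 a ->
  coutput (run_at T (interleave x y) b0) 0 -> pseudo x s.
Proof.
move=> [_ hb0 minb0] b0a ob0.
have [rv r0 rs rl] := run_at_run T (interleave x y).
split; split.
- by move=> b c d; rewrite !rltP; apply: ordinal_in_trans (og d).
- move=> b c d; rewrite !rltP => bd.
  case: (ordinal_trichotomy (og b) (og c)) => [|<-|cb]; [by left|by right|right].
  exact: ordinal_in_trans (og d) cb bd.
- move=> b c /rltP bc.
  (* The ordinal [a] may have a last element without successor in [a]. Below some [g0 c], however,
     the successor of [g0 b] is at most [g0 c] and has a name. *)
  have Sba : vin (vsucc (g0 b)) a.
    case: (ordinal_trichotomy (ordinal_succ (og b)) (og c)) => [H|->//|].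
    - exact: (ordinal_in_trans oa H).
    - by move/(ordinal_succ_le (og c) bc).
  have [d bd] := g0_surj Sba; exists d; apply/rpcover.
  by symmetry.
- have [b wb] := g0_surj omega_a; exists b; split.
    by move=> c /rltP; rewrite -wb => -[k ck]; exists k; apply: rpfin.
  move=> k; have kw : vin (vnat k) (g0 b) by rewrite -wb; exists k.
  have [c kc] := g0_down kw; exists c; split; first by apply/rltP; rewrite -kc.
  by apply: rpfin; symmetry.
- by move=> u w v /rpeqP uw; rewrite !rmemP uw.
- move=> u b; rewrite rlevP vin_Lrel; split.
  + move=> [v vb]; have [c vc] := g0_down vb; rewrite vc => /vin_Def [n [p [e' de']]].
    have /choice [e ee'] : forall i, exists w, veq (e' i) (g1 w).
      by move=> i; apply: g1_lev (proj1 de' i).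
    have ec i : plev s (e i) c by apply/rlevP; rewrite -ee'; apply: (proj1 de').
    exists c; split; first by apply/rltP; rewrite -vc.
    by exists n, p, e; split=> //; apply/(rpdefinesP _ _ ec ee').
  + move=> [c [/rltP cb [n [p [e [ec ue]]]]]]; exists (g0 c) => //.
    apply/vin_Def; exists n, p, (fun i => g1 (e i)).
    exact/(rpdefinesP _ _ ec).
- move=> c n p e ec.
  have e'c i : vin (g1 (e i)) (Lrel x (g0 c)) by apply/rlevP.
  have := proj1 (vsepP x p (vsep _ _) e'c) (veq_refl _); set v := vsep _ _ => dv.
  have vL : vin v (Lrel x a).
    apply/vin_Lrel; exists (g0 c) => //; apply/vin_Def.
    by exists n, p, (fun i => g1 (e i)).
  have [u vu] := g1_surj vL; exists u; apply/(rpdefinesP _ _ ec (fun i => veq_refl _)).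
  by split=> // w; rewrite -vu; apply: (proj2 dv).
- move=> n p d e c cc.
  (* Here the stages are true ordinals, so foundation gives the least collecting level. *)
  have [v [k vk kc] vmin] := vin_min (ex_intro (fun v => exists2 k, veq v (g0 k) &
    pcollects x s p d e k) (g0 c) (ex_intro2 _ _ c (veq_refl _) cc)).
  exists k; split=> // k' /rltP; rewrite -vk => k'v ck'.
  by apply: (vmin _ k'v); exists k'.
- move=> b H; rewrite -r0; apply: rv; apply: vemptyP => v /[dup] vb /g0_down [c vc].
  by apply: (H c); apply/rltP; rewrite -vc.
- by move=> b c /rpcover cb; rewrite /= (rv _ _ cb) rs.
- move=> b [c /rltP cb] H.
  have lb : limit_ordinal (g0 b).
    apply/(limit_ordinalP (og b)); split; first by exists (g0 c).
    move=> v /[dup] vb /g0_down [d vd]; have /H [d' [/rltP d'b /rltP dd']] : plt s d b.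
      by apply/rltP; rewrite -vd.
    by exists (g0 d') => //; rewrite vd.
  have [qb hb ib cb' ob] := rl _ lb.
  have E (t : config T -> nat -> bool) n : plimsup s t b n <->
      limsup1 (g0 b) (fun v => t (run_at T (interleave x y) v) n).
    split=> L.
    - move=> v /[dup] vb /g0_down [d vd]; have [|d' [/rltP d'b dd' td']] := L d.
        by apply/rltP; rewrite -vd.
      exists (g0 d'); split=> //; rewrite vd; apply/ordinal_sub => // H'.
      by apply: dd'; apply/rltP.
    - move=> d /rltP db; have [v [vb dv tv]] := L (g0 d) db.
      have [d' vd'] := g0_down vb; exists d'; split.
      + by apply/rltP; rewrite -vd'.
      + move=> /rltP d'd; move: dv; rewrite vd' => /ordinal_sub.
        by move=> /(_ (og d) (og d')); apply.
      + by rewrite /= -(rv _ _ vd').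
  by split=> // n; rewrite ?ib ?cb' ?ob; symmetry; apply: E.
- have [b b0b] := g0_surj b0a; exists b; split; last by rewrite /= -(rv _ _ b0b).
  split; first by rewrite /= -(rv _ _ b0b).
  by move=> c /rltP; rewrite -b0b => /minb0.
Qed.

End RealHierarchy.

Lemma pseudo_complete (T : ittm) x y b : halts_first T (interleave x y) b ->
  vin b vomega1 -> accepts T (interleave x y) ->
  exists s : pstruct T, pseudo x s /\ pwit s = y.
Proof.
move=> fb [t bt] /(accepts_first fb) ob.
(* The tree of a countable ordinal above both [b] and omega. *)
pose t' := CNode (fun n => if n is 0 then t else CNode nat_tree).
have wa : vin vomega (cord t').
  by apply/vin_cord; exists 1; right; symmetry; apply: cord_omega.
have ba : vin b (cord t') by apply/vin_cord; exists 0; right.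
have [g0 [g0_in g0_surj]] := enumerable_total (enumerable_cord t') (ex_intro (vin^~ _) _ ba).
have [g1 [g1_in g1_surj]] := enumerable_total (enumerable_Lrel_cord x t')
  (ex_intro (vin^~ _) _ (Lrel_in x ba)).
exists (real_pstruct T x y g0 g1); split=> //.
exact: (real_pseudo (ordinal_cord t') wa g0_in g0_surj g1_in g1_surj fb ba ob).
Qed.

(** * Analytic sets *)

Section Analytic.
Variable K : Type.
Local Notation X := (nat -> K).

Definition agree A n (u v : nat -> A) : Prop := forall i, i < n -> u i = v i.

Lemma agree_le A m n (u v : nat -> A) : m <= n -> agree n u v -> agree m u v.
Proof. by move=> mn uv i im; apply: uv; apply: leq_trans im mn. Qed.

(** Closedness in the product topology of discrete spaces: a point whose finite restrictions all
    extend to points of [C] lies in [C]. *)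
Definition closed_rel (C : X -> (nat -> nat) -> Prop) : Prop := forall u w,
  (forall n, exists u' w', [/\ agree n u u', agree n w w' & C u' w']) -> C u w.

Definition analytic (P : X -> Prop) : Prop :=
  exists2 C, closed_rel C & forall u, P u <-> exists w, C u w.

Lemma analytic_ext P Q : (forall u, P u <-> Q u) -> analytic P -> analytic Q.
Proof. by move=> PQ [C cC PC]; exists C => // u; rewrite -PQ. Qed.

Definition local (P : X -> Prop) : Prop :=
  forall u, exists n, forall u', agree n u u' -> (P u <-> P u').

Lemma analytic_local P : local P -> analytic P.
Proof.
move=> lP; exists (fun u _ => P u) => [u w H|u].
  have [n nP] := lP u; have [u' [_ [uu' _ Pu']]] := H n.
  by apply/(nP u').
by split=> [|[_ //]]; exists (fun=> 0).
Qed.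

Lemma analytic_exists (P : nat -> X -> Prop) :
  (forall i, analytic (P i)) -> analytic (fun u => exists i, P i u).
Proof.
move=> aP; have /choice [C CP] : forall i, exists C, closed_rel C /\
    forall u, P i u <-> exists w, C u w.
  by move=> i; have [C cC PC] := aP i; exists C.
exists (fun u w => C (w 0) u (fun n => w n.+1)) => [u w H|u].
  have [cC _] := CP (w 0); apply: cC => n; have [u' [w' [uu' ww' Cu']]] := H n.+1.
  exists u', (fun n => w' n.+1); split; first exact: agree_le uu'.
    by move=> i ni; exact: (ww' i.+1 ni).
  by rewrite (ww' 0).
split=> [[i]|[w Cw]].
  have [_ PC] := CP i => /PC [w Cw].
  by exists (fun n => if n is m.+1 then w m else i).
by exists (w 0); have [_ PC] := CP (w 0); apply/PC; exists (fun n => w n.+1).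
Qed.

Lemma analytic_forall (P : nat -> X -> Prop) :
  (forall i, analytic (P i)) -> analytic (fun u => forall i, P i u).
Proof.
move=> aP; have /choice [C CP] : forall i, exists C, closed_rel C /\
    forall u, P i u <-> exists w, C u w.
  by move=> i; have [C cC PC] := aP i; exists C.
exists (fun u w => forall i, C i u (fun m => w (pickle (i, m)))) => [u w H i|u].
  have [cC _] := CP i; apply: cC => n.
  (* The first [n] entries of the i-th witness sit at the cells [pickle (i, m)] of [w], and the
     agreement has to cover all of these. *)
  have [u' [w' [uu' ww' Cu']]] := H (maxn n (\max_(m < n) (pickle (i, nat_of_ord m)).+1)).
  exists u', (fun m => w' (pickle (i, m))); split=> //.
    by apply: agree_le uu'; apply: leq_maxl.
  move=> m mn; apply: ww'; apply: leq_trans (leq_maxr _ _).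
  exact: (@leq_bigmax _ (fun m : 'I_n => (pickle (i, nat_of_ord m)).+1) (Ordinal mn)).
split=> [H|[w H] i]; last first.
  by have [_ PC] := CP i; apply/PC; exists (fun m => w (pickle (i, m))).
have /choice [w Cw] : forall i, exists w, C i u w.
  by move=> i; have [_ PC] := CP i; apply/PC.
exists (fun k => if unpickle k is Some (i, m) then w i m else 0) => i.
by have -> : (fun m => if unpickle (pickle (i, m)) is Some (i, m) then w i m else 0) = w i
  by apply/funext => m; rewrite pickleK.
Qed.

Inductive borel : (X -> Prop) -> Prop :=
  | borel_local P : local P -> borel P
  | borel_not P : borel P -> borel (fun u => ~ P u)
  | borel_exN (P : nat -> X -> Prop) :
      (forall i, borel (P i)) -> borel (fun u => exists i, P i u).

(** Analytic sets are not closed under complement, so the induction carries a set and its complement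
    together. *)
Lemma borel_analytic P : borel P -> analytic P.
Proof.
move=> bP; suff: analytic P /\ analytic (fun u => ~ P u) by case.
elim: bP => {}P => [lP|_ [aP aN]|_ IH].
- split; apply: analytic_local => // u; have [n nP] := lP u.
  by exists n => u' /nP H; rewrite H.
- split=> //; apply: analytic_ext aP => u.
  by split=> [? []|/contrapT].
- split; first by apply: analytic_exists => i; case: (IH i).
  apply: (@analytic_ext (fun u => forall i, ~ P i u)).
    by move=> u; split=> [H [i /H]|H i Pi] //; apply: H; exists i.
  by apply: analytic_forall => i; case: (IH i).
Qed.

Lemma borel_ext (P Q : X -> Prop) : (forall u, P u <-> Q u) -> borel P -> borel Q.
Proof. by move=> PQ bP; rewrite (_ : Q = P) //; apply/funext => u; apply/propext; rewrite PQ. Qed.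

Lemma borel_const (A : Prop) : borel (fun=> A).
Proof. by apply: borel_local => u; exists 0. Qed.

Definition covered A : Prop := exists f : nat -> option A, forall a, exists n, f n = Some a.

Lemma covered_countType (A : countType) : covered A.
Proof. by exists unpickle => a; exists (pickle a); rewrite pickleK. Qed.

Lemma covered_form n : covered (form n).
Proof.
exists (fun k => if unpickle k is Some t then form_of_tree t n else None) => p.
by have [t tp] := form_of_tree_surj p; exists (pickle t); rewrite pickleK.
Qed.

Lemma covered_fun n : covered ('I_n -> nat).
Proof.
exists (fun k => omap (fun (s : seq nat) (i : 'I_n) => nth 0 s i) (unpickle k)) => e.
exists (pickle [seq e i | i <- enum 'I_n]); rewrite pickleK /=; congr Some.
by apply/funext => i; rewrite (nth_map i) ?size_enum_ord // nth_ord_enum.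
Qed.

Lemma borel_exists A (P : A -> X -> Prop) : covered A ->
  (forall a, borel (P a)) -> borel (fun u => exists a, P a u).
Proof.
move=> [f fP] bP.
apply: (@borel_ext (fun u => exists n, if f n is Some a then P a u else False)).
  move=> u; split=> [[n]|[a Pa]]; first by case: (f n) => // a; exists a.
  by have [n fn] := fP a; exists n; rewrite fn.
apply: borel_exN => n; case: (f n) => [a|]; [exact: bP|exact: borel_const].
Qed.

Lemma borel_forall A (P : A -> X -> Prop) : covered A ->
  (forall a, borel (P a)) -> borel (fun u => forall a, P a u).
Proof.
move=> cA bP; apply: (@borel_ext (fun u => ~ exists a, ~ P a u)).
  by move=> u; split=> [H a|H [a]]; [apply: contrapT => na; apply: H; exists a|apply].
by apply: borel_not; apply: borel_exists => // a; apply: borel_not.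
Qed.

Lemma borel_forallN (P : nat -> X -> Prop) :
  (forall a, borel (P a)) -> borel (fun u => forall a, P a u).
Proof. by apply: borel_forall; apply: covered_countType. Qed.

Lemma borel_or P Q : borel P -> borel Q -> borel (fun u => P u \/ Q u).
Proof.
move=> bP bQ; apply: (@borel_ext (fun u => exists b : nat, if b is 0 then P u else Q u)).
  by move=> u; split=> [[[|n]]|[]] //; [left|right|exists 0|exists 1].
by apply: borel_exN => -[].
Qed.

Lemma borel_imp P Q : borel P -> borel Q -> borel (fun u => P u -> Q u).
Proof.
move=> bP bQ; apply: (@borel_ext (fun u => ~ P u \/ Q u)); last first.
  by apply: borel_or => //; apply: borel_not.
move=> u; split=> [[]//|H]; have [Pu|] := pselect (P u); [by right; apply: H|by left].
Qed.

Lemma borel_and P Q : borel P -> borel Q -> borel (fun u => P u /\ Q u).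
Proof.
move=> bP bQ; apply: (@borel_ext (fun u => ~ (~ P u \/ ~ Q u))); last first.
  by apply: borel_not; apply: borel_or; apply: borel_not.
move=> u; split=> [H|[Pu Qu] []//].
by split; apply: contrapT => n; apply: H; [left|right].
Qed.

Lemma borel_and3 P Q R : borel P -> borel Q -> borel R ->
  borel (fun u => [/\ P u, Q u & R u]).
Proof.
move=> bP bQ bR; apply: (@borel_ext (fun u => P u /\ Q u /\ R u)).
  by move=> u; split=> [[? []]|[]].
by apply: borel_and => //; apply: borel_and.
Qed.

Lemma borel_and4 P Q R S : borel P -> borel Q -> borel R -> borel S ->
  borel (fun u => [/\ P u, Q u, R u & S u]).
Proof.
move=> bP bQ bR bS; apply: (@borel_ext (fun u => P u /\ [/\ Q u, R u & S u])).
  by move=> u; split=> [[? []]|[]].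
by apply: borel_and => //; apply: borel_and3.
Qed.

Lemma borel_iff P Q : borel P -> borel Q -> borel (fun u => P u <-> Q u).
Proof. by move=> bP bQ; apply: borel_and; apply: borel_imp. Qed.

Lemma borel_gsat (E Q : X -> nat -> nat -> Prop) (R D : X -> nat -> Prop) :
  (forall a b, borel (fun u => E u a b)) -> (forall a b, borel (fun u => Q u a b)) ->
  (forall a, borel (R^~ a)) -> (forall a, borel (D^~ a)) ->
  forall n (p : form n) e, borel (fun u => gsat (E u) (Q u) (R u) (D u) p e).
Proof.
move=> bE bQ bR bD n p.
elim: p => {n} [n i k|n i k|n i|n q IH|n q IHq r IHr|n q IH|n i q IH] e //=.
- exact: borel_not.
- exact: borel_and.
- by apply: borel_exN => v; apply: borel_and.
- by apply: borel_exN => v; apply: borel_and3.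
Qed.

Definition cont A (f : X -> A) : Prop :=
  forall u, exists n, forall u', agree n u u' -> f u = f u'.

Lemma cont_const A (a : A) : cont (fun=> a).
Proof. by move=> u; exists 0. Qed.

Lemma cont_nth k : cont (fun u => u k).
Proof. by move=> u; exists k.+1 => u'; apply. Qed.

(** This handles a tape read at the head position, where the index itself depends on the point. *)
Lemma cont_bind A B (f : X -> A) (g : A -> X -> B) :
  cont f -> (forall a, cont (g a)) -> cont (fun u => g (f u) u).
Proof.
move=> cf cg u; have [m mP] := cf u; have [n nP] := cg (f u) u.
exists (maxn m n) => u' uu'.
rewrite -(mP u') ?(nP u') //; apply: agree_le uu'; [exact: leq_maxr|exact: leq_maxl].
Qed.

Lemma cont_comp A B (h : A -> B) (f : X -> A) : cont f -> cont (fun u => h (f u)).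
Proof. by move=> cf; apply: (cont_bind (g := fun a _ => h a)) => // a; apply: cont_const. Qed.

Lemma cont_comp2 A B C (h : A -> B -> C) (f : X -> A) (g : X -> B) :
  cont f -> cont g -> cont (fun u => h (f u) (g u)).
Proof. by move=> cf cg; apply: (cont_bind (g := fun a u => h a (g u))) => // a; apply: cont_comp. Qed.

Lemma borel_cont A (S : A -> Prop) (f : X -> A) : cont f -> borel (fun u => S (f u)).
Proof.
move=> cf; apply: borel_local => u; have [n nP] := cf u.
by exists n => u' /nP ->.
Qed.

Lemma borel_contb (f : X -> bool) : cont f -> borel (fun u => f u).
Proof. exact: (borel_cont (fun b : bool => is_true b)). Qed.

Lemma borel_cont2 A B (S : A -> B -> Prop) (f : X -> A) (g : X -> B) :
  cont f -> cont g -> borel (fun u => S (f u) (g u)).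
Proof.
move=> cf cg; apply: (borel_cont (fun ab => S ab.1 ab.2) (f := fun u => (f u, g u))).
exact: (cont_comp2 pair).
Qed.

End Analytic.

(** Closure under projection: the quantified sequence and the old witness are interleaved into one
    new witness. *)
Lemma analytic_existsR (P : (nat -> bool) -> Prop) (Q : (nat -> bool * nat) -> Prop) :
  analytic Q -> (forall x, P x <-> exists z : nat -> nat, Q (fun n => (x n, z n))) ->
  analytic P.
Proof.
move=> [C cC QC] PQ.
exists (fun x w => C (fun n => (x n, w n.*2)) (fun n => w n.*2.+1)) => [x w H|x].
  apply: cC => n; have [x' [w' [xx' ww' Cx']]] := H n.*2.
  exists (fun n => (x' n, w' n.*2)), (fun n => w' n.*2.+1); split=> //= i ni.
    by rewrite xx' ?ww' ?ltn_double // -addnn ltn_addr.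
  by rewrite ww' // ltn_Sdouble.
rewrite PQ; split=> [[z /QC [w Cw]]|[w Cw]]; last first.
  by exists (fun n => w n.*2); apply/QC; exists (fun n => w n.*2.+1).
exists (fun k => if odd k then w k./2 else z k./2).
have -> : (fun n => (x n, if odd n.*2 then w (n.*2)./2 else z (n.*2)./2)) = (fun n => (x n, z n)).
  by apply/funext => n; rewrite odd_double doubleK.
suff -> : (fun n => if odd n.*2.+1 then w (n.*2.+1)./2 else z (n.*2.+1)./2) = w by [].
by apply/funext => n; rewrite /= odd_double uphalf_double.
Qed.

(** * Coding structures by sequences, and the complexity of [pseudo] *)

Section Coding.
Variable T : ittm.
Local Notation X := (nat -> bool * nat).

Definition code (i b c : nat) : nat := pickle (i, b, c).
Definition slot (u : X) i b c : nat := (u (code i b c)).2.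

(** Slots 3 to 7 hold the components of a configuration. Every sequence decodes to some structure,
    so all constraints stay in [pseudo]. *)
Definition dec_struct (u : X) : pstruct T := {|
  plt b c := slot u 0 b c != 0;
  pmem b c := slot u 1 b c != 0;
  plev b c := slot u 2 b c != 0;
  pcfg b := Config (nth (q_start T) (enum (state T)) (slot u 3 b 0)) (slot u 4 b 0)
    (fun n => slot u 5 b n != 0) (fun n => slot u 6 b n != 0) (fun n => slot u 7 b n != 0);
  pwit n := slot u 8 n 0 != 0
|}.

Definition dec_real (u : X) (n : nat) : bool := (u n).1.

Lemma dec_struct_surj x (s : pstruct T) :
  exists z : nat -> nat, dec_struct (fun n => (x n, z n)) = s.
Proof.
case: s => lt mem lev cfg wit.
pose z k : nat := match unpickle k with
  | Some (0, b, c) => lt b c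
  | Some (1, b, c) => mem b c
  | Some (2, b, c) => lev b c
  | Some (3, b, _) => index (cstate (cfg b)) (enum (state T))
  | Some (4, b, _) => chead (cfg b)
  | Some (5, b, n) => cinput (cfg b) n
  | Some (6, b, n) => cscratch (cfg b) n
  | Some (7, b, n) => coutput (cfg b) n
  | Some (_, n, _) => wit n
  | None => 0
  end.
have b0 (b : bool) : ((b : nat) != 0) = b by case: b.
exists z; rewrite /dec_struct /slot /code /z /=; f_equal.
- by apply/funext => b; apply/funext => c; rewrite pickleK b0.
- by apply/funext => b; apply/funext => c; rewrite pickleK b0.
- by apply/funext => b; apply/funext => c; rewrite pickleK b0.
- apply/funext => b; rewrite !pickleK nth_index ?mem_enum //.
  case cb: (cfg b) => [q h i s o] /=.
  by f_equal; apply/funext => n; rewrite pickleK cb b0.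
- by apply/funext => n; rewrite pickleK b0.
Qed.

(** Finitely many entries cannot determine whole tapes, so continuity is asked of the state, the
    head and each single cell. *)
Definition ccont (c : X -> config T) : Prop :=
  [/\ cont (fun u => cstate (c u)), cont (fun u => chead (c u)),
    forall n, cont (fun u => cinput (c u) n),
    forall n, cont (fun u => cscratch (c u) n) &
    forall n, cont (fun u => coutput (c u) n)].

Lemma cont_slot i b c : cont (fun u => slot u i b c).
Proof. by apply: (cont_comp snd); apply: cont_nth. Qed.

Lemma ccont_dec b : ccont (fun u => pcfg (dec_struct u) b).
Proof.
have sb i n : cont (fun u => slot u i b n != 0).
  by apply: (cont_comp (fun k => k != 0)); apply: cont_slot.
split=> [||n|n|n]; [|exact: cont_slot|exact: sb|exact: sb|exact: sb].
exact: (cont_comp (fun k => nth (q_start T) (enum (state T)) k) (cont_slot _ _ _)).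
Qed.

Lemma ccont_init : ccont (fun u => init_config T (interleave (dec_real u) (pwit (dec_struct u)))).
Proof.
split=> /=; try (move=> n); try exact: cont_const.
rewrite /interleave /dec_real /=; case: (odd n).
- by apply: (cont_comp (fun k => k != 0)); apply: cont_slot.
- by apply: (cont_comp fst); apply: cont_nth.
Qed.

Lemma ccont_step c : ccont c -> ccont (fun u => step (c u)).
Proof.
move=> [cq ch ci cs co].
have cp : cont (fun u => program (cstate (c u)) (cinput (c u) (chead (c u)),
    cscratch (c u) (chead (c u)), coutput (c u) (chead (c u)))).
  apply: (cont_comp2 (fun q b => program q b)) => //.
  apply: (cont_comp2 pair); first apply: (cont_comp2 pair).
  - exact: (cont_bind (g := fun n u => cinput (c u) n)).
  - exact: (cont_bind (g := fun n u => cscratch (c u) n)).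
  - exact: (cont_bind (g := fun n u => coutput (c u) n)).
have cw (t : config T -> nat -> bool) (f : bool * bool * bool -> bool) n :
    (forall n, cont (fun u => t (c u) n)) ->
    cont (fun u => let: (q, b, d) := program (cstate (c u)) (cinput (c u) (chead (c u)),
      cscratch (c u) (chead (c u)), coutput (c u) (chead (c u))) in
      write (t (c u)) (chead (c u)) (f b) n).
  move=> ct.
  apply: (cont_comp2 (fun p tn => let: (q, b, d) := p.1 in if n == p.2 then f b else tn)
    (f := fun u => (_, chead (c u)))) => //.
  exact: (cont_comp2 pair).
have E A (f : state T -> bool * bool * bool -> direction -> A) p :
  (let: (q, b, d) := p in f q b d) = f p.1.1 p.1.2 p.2 by case: p => [[]].
split.
- have -> : (fun u => cstate (step (c u))) = (fun u => (program (cstate (c u))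
    (cinput (c u) (chead (c u)), cscratch (c u) (chead (c u)), coutput (c u) (chead (c u)))).1.1).
    by apply/funext => u; rewrite /step; case: program => [[q [[bi bs] bo]] d].
  exact: (cont_comp (fun p => p.1.1)).
- have -> : (fun u => chead (step (c u))) = (fun u => (fun p (h : nat) =>
      if p is MoveLeft then h.-1 else h.+1) (program (cstate (c u))
    (cinput (c u) (chead (c u)), cscratch (c u) (chead (c u)), coutput (c u) (chead (c u)))).2
      (chead (c u))).
    by apply/funext => u; rewrite /step; case: program => [[q [[bi bs] bo]] d].
  apply: (cont_comp2 (fun p (h : nat) => if p is MoveLeft then h.-1 else h.+1)) => //.
  exact: (cont_comp snd).
- move=> n; have := cw (@cinput T) (fun b => b.1.1) n ci; congr cont; apply/funext => u.
  by rewrite /step; case: program => [[q [[bi bs] bo]] d].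
- move=> n; have := cw (@cscratch T) (fun b => b.1.2) n cs; congr cont; apply/funext => u.
  by rewrite /step; case: program => [[q [[bi bs] bo]] d].
- move=> n; have := cw (@coutput T) (fun b => b.2) n co; congr cont; apply/funext => u.
  by rewrite /step; case: program => [[q [[bi bs] bo]] d].
Qed.

Lemma borel_config_eq c c' : ccont c -> ccont c' -> borel (fun u => c u = c' u).
Proof.
move=> [cq ch ci cs co] [cq' ch' ci' cs' co'].
apply: (@borel_ext _ (fun u => (cstate (c u) = cstate (c' u) /\ chead (c u) = chead (c' u)) /\
  [/\ forall n, cinput (c u) n = cinput (c' u) n,
      forall n, cscratch (c u) n = cscratch (c' u) n &
      forall n, coutput (c u) n = coutput (c' u) n])).
  move=> u; split=> [[[q h] [i s o]]|->//].
  by apply: config_eq => // n; rewrite (i, s, o).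
apply: borel_and; first by apply: borel_and; apply: (borel_cont2 eq).
by apply: borel_and3; apply: borel_forallN => n; apply: (borel_cont2 eq).
Qed.

Local Notation S u := (dec_struct u).

Lemma borel_lt a b : borel (fun u => plt (S u) a b).
Proof. exact: (borel_cont (fun k => k != 0) (cont_slot _ _ _)). Qed.

Lemma borel_mem a b : borel (fun u => pmem (S u) a b).
Proof. exact: (borel_cont (fun k => k != 0) (cont_slot _ _ _)). Qed.

Lemma borel_lev a b : borel (fun u => plev (S u) a b).
Proof. exact: (borel_cont (fun k => k != 0) (cont_slot _ _ _)). Qed.

Lemma borel_peq a b : borel (fun u => peq (S u) a b).
Proof. by apply: borel_forallN => t; apply: borel_iff; apply: borel_mem. Qed.

Lemma borel_pnat k a : borel (fun u => pnat (S u) k a).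
Proof.
elim: k a => [|k IH] a /=.
  by apply: borel_forallN => t; apply: borel_not; apply: borel_mem.
apply: borel_exN => v; apply: borel_and => //; apply: borel_forallN => w.
apply: borel_iff; first exact: borel_mem.
by apply: borel_or; [apply: borel_mem|apply: borel_peq].
Qed.

Lemma borel_cover a b : borel (fun u => pcover (S u) a b).
Proof.
apply: borel_and; first exact: borel_lt.
apply: borel_forallN => d; apply: borel_imp; first exact: borel_lt.
by apply: borel_not; apply: borel_lt.
Qed.

Lemma borel_pfin k a : borel (fun u => pfin (S u) k a).
Proof.
elim: k a => [|k IH] a /=.
  by apply: borel_forallN => t; apply: borel_not; apply: borel_lt.
by apply: borel_exN => v; apply: borel_and => //; apply: borel_cover.
Qed.

Lemma borel_psat c n (p : form n) e : borel (fun u => psat (dec_real u) (S u) c p e).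
Proof.
apply: borel_gsat.
- exact: borel_mem.
- exact: borel_peq.
- move=> a; apply: borel_exN => k; apply: borel_and; last exact: borel_pnat.
  by apply: borel_contb; apply: (cont_comp fst); apply: cont_nth.
- by move=> a; apply: borel_lev.
Qed.

Lemma borel_pdefines c n (p : form n.+1) e v :
  borel (fun u => pdefines (dec_real u) (S u) c p e v).
Proof.
apply: borel_forallN => w; apply: borel_iff; first exact: borel_mem.
by apply: borel_and; [apply: borel_lev|apply: borel_psat].
Qed.

Lemma borel_pcollects n (p : form n.+2) a e c :
  borel (fun u => pcollects (dec_real u) (S u) p a e c).
Proof.
apply: borel_and3; first exact: borel_lev.
  by apply: borel_forall; [apply: covered_countType|move=> i; apply: borel_lev].
apply: borel_forallN => v; do 2![apply: borel_imp; first by [apply: borel_lev|apply: borel_mem]].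
by apply: borel_exN => w; apply: borel_and; [apply: borel_lev|apply: borel_psat].
Qed.

Lemma borel_plimsup t b n : (forall b n, cont (fun u => t (pcfg (S u) b) n)) ->
  borel (fun u => plimsup (S u) t b n).
Proof.
move=> ct; apply: borel_forallN => c; apply: borel_imp; first exact: borel_lt.
apply: borel_exN => d; apply: borel_and3; first exact: borel_lt.
  by apply: borel_not; apply: borel_lt.
exact: borel_contb.
Qed.

Lemma borel_phalts b : borel (fun u => phalts (S u) b).
Proof.
have cq c := let: And5 H _ _ _ _ := ccont_dec c in H.
apply: borel_and; first exact: (borel_cont (fun q => q = q_halt T) (cq b)).
apply: borel_forallN => c; apply: borel_imp; first exact: borel_lt.
exact: (borel_cont (fun q => q <> q_halt T) (cq c)).
Qed.

Lemma borel_pseudo : borel (fun u => pseudo (dec_real u) (S u)).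
Proof.
apply: borel_and3; apply: borel_and4.
- do 3![apply: borel_forallN => ?]; apply: borel_imp; first exact: borel_lt.
  by apply: borel_imp; apply: borel_lt.
- do 3![apply: borel_forallN => ?]; apply: borel_imp; first exact: borel_lt.
  by apply: borel_or; apply: borel_lt.
- do 2![apply: borel_forallN => ?]; apply: borel_imp; first exact: borel_lt.
  by apply: borel_exN => c; apply: borel_cover.
- apply: borel_exN => b; apply: borel_and.
  + apply: borel_forallN => c; apply: borel_imp; first exact: borel_lt.
    by apply: borel_exN => k; apply: borel_pfin.
  + apply: borel_forallN => k; apply: borel_exN => c.
    by apply: borel_and; [apply: borel_lt|apply: borel_pfin].
- do 3![apply: borel_forallN => ?]; apply: borel_imp; first exact: borel_peq.
  by apply: borel_imp; apply: borel_mem.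
- do 2![apply: borel_forallN => ?]; apply: borel_iff; first exact: borel_lev.
  apply: borel_exN => c; apply: borel_and; first exact: borel_lt.
  apply: borel_exN => n; apply: borel_exists; first exact: covered_form.
  move=> p; apply: borel_exists; first exact: covered_fun.
  move=> e; apply: borel_and; last exact: borel_pdefines.
  apply: borel_forall => [|i]; [exact: covered_countType|exact: borel_lev].
- apply: borel_forallN => c; apply: borel_forallN => n.
  apply: borel_forall; first exact: covered_form.
  move=> p; apply: borel_forall; first exact: covered_fun.
  move=> e; apply: borel_imp.
    apply: borel_forall => [|i]; [exact: covered_countType|exact: borel_lev].
  by apply: borel_exN => v; apply: borel_pdefines.
- apply: borel_forallN => n; apply: borel_forall; first exact: covered_form.
  move=> p; apply: borel_forallN => a; apply: borel_forall; first exact: covered_fun.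
  move=> e; apply: borel_forallN => c; apply: borel_imp; first exact: borel_pcollects.
  apply: borel_exN => d; apply: borel_and; first exact: borel_pcollects.
  apply: borel_forallN => d'; apply: borel_imp; first exact: borel_lt.
  by apply: borel_not; apply: borel_pcollects.
- apply: borel_forallN => b; apply: borel_imp.
    by apply: borel_forallN => c; apply: borel_not; apply: borel_lt.
  by apply: borel_config_eq; [apply: ccont_dec|apply: ccont_init].
- do 2![apply: borel_forallN => ?]; apply: borel_imp; first exact: borel_cover.
  by apply: borel_config_eq; [|apply: ccont_step]; apply: ccont_dec.
- apply: borel_forallN => b; apply: borel_imp.
    by apply: borel_exN => c; apply: borel_lt.
  apply: borel_imp.
    apply: borel_forallN => c; apply: borel_imp; first exact: borel_lt.
    by apply: borel_exN => d; apply: borel_and; apply: borel_lt.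
  have cf c := ccont_dec c; have [cq ch _ _ _] := cf b.
  have lim (t : config T -> nat -> bool) : (forall c n, cont (fun u => t (pcfg (S u) c) n)) ->
      borel (fun u => forall n, t (pcfg (S u) b) n <-> plimsup (S u) t b n).
    move=> ct; apply: borel_forallN => n; apply: borel_iff; first exact: borel_contb.
    exact: borel_plimsup.
  apply: (@borel_ext _ (fun u => (cstate (pcfg (S u) b) = q_limit T /\ chead (pcfg (S u) b) = 0) /\
    [/\ forall n, cinput (pcfg (S u) b) n <-> plimsup (S u) (@cinput T) b n,
      forall n, cscratch (pcfg (S u) b) n <-> plimsup (S u) (@cscratch T) b n &
      forall n, coutput (pcfg (S u) b) n <-> plimsup (S u) (@coutput T) b n])).
    by move=> u; split=> [[[? ?] [? ? ?]]|[]].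
  apply: borel_and.
    apply: borel_and; first exact: (borel_cont (fun q => q = q_limit T) cq).
    exact: (borel_cont (fun h => h = 0) ch).
  by apply: borel_and3; apply: lim => c n; have [_ _ ci cs co] := cf c.
- apply: borel_exN => b; apply: borel_and; first exact: borel_phalts.
  by apply: borel_contb; have [_ _ _ _ co] := ccont_dec b.
Qed.

End Coding.

(** The time bound enters in both directions: it makes a true halting stage countable, hence
    representable on [nat], and it forces the run in a guessed structure to be the true one up to
    halting. *)
Lemma NPplus_analytic A : NPplus A -> analytic A.
Proof.
move=> [T [AT Tfast]].
apply: (analytic_existsR (borel_analytic (borel_pseudo T))) => x; rewrite AT; split.
- move=> [y acc]; have [w w1 [b [c [/halts_atP [fb _] bw]]]] := Tfast x y.
  (* Minimality compares [w] with the [omega_1^x] known to lie below [vomega1]. *)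
  have [w' w1' w'sub] := omega1_exists x.
  have ww' : vsub w w' by case: w1 w1' => _ _ wmin [aw' ow' _]; apply: wmin.
  have [s [ps sy]] := pseudo_complete fb (w'sub _ (ww' _ bw)) acc.
  have [z zs] := dec_struct_surj x s; exists z; rewrite zs.
  exact: ps.
- move=> [z ps]; exists (pwit (dec_struct T (fun n => (x n, z n)))).
  have [w w1 hw] := Tfast x (pwit (dec_struct T (fun n => (x n, z n)))).
  exact: (pseudo_accepts ps w1 hw).
Qed.

(** * A counter machine *)

(** The real lists stages of the form: [a] zeros, a one, [b] zeros, a one; each is an edge from [a]
    to [b]. In [Wait] the guessed bit decides whether to follow the edge. If so, [Cmp] counts the
    counter down along the first block and tests for zero, and [Fill] counts it up along the second.
    If not, [SkipA] and [SkipB] pass over the blocks. *)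
Variant mode := Wait | SkipA | SkipB | Cmp | Fill.
Variant op := Dec | Zero | Inc.

Variant cstates :=
  | Start | Limit | Halt | Second | Dead | Push | Flash
  | ReadX of mode | ReadY of mode & bool | Seek of op | Return of mode.

Definition modes := [:: Wait; SkipA; SkipB; Cmp; Fill].
(** The order matters: [cstates_code] is the place of a state in this list, ten single states
    followed by four groups of five modes. *)
Definition all_cstates : seq cstates :=
  [:: Start; Limit; Halt; Second; Dead; Push; Flash; Seek Dec; Seek Zero; Seek Inc] ++
  map ReadX modes ++ map (ReadY^~ true) modes ++ map (ReadY^~ false) modes ++
  map Return modes.

Definition mode_code (m : mode) : nat :=
  match m with Wait => 0 | SkipA => 1 | SkipB => 2 | Cmp => 3 | Fill => 4 end.

Definition cstates_code (q : cstates) : 'I_30 :=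
  inord match q with
  | Start => 0 | Limit => 1 | Halt => 2 | Second => 3 | Dead => 4 | Push => 5
  | Flash => 6 | Seek Dec => 7 | Seek Zero => 8 | Seek Inc => 9
  | ReadX m => 10 + mode_code m | ReadY m true => 15 + mode_code m
  | ReadY m false => 20 + mode_code m | Return m => 25 + mode_code m
  end.

Lemma cstates_codeK : cancel cstates_code (fun i => nth Start all_cstates i).
Proof. by do ?case; rewrite /cstates_code inordK. Qed.

HB.instance Definition _ := Finite.copy cstates (can_type cstates_codeK).

(** [y] is the guessed bit and [v] the listed one. A result [inl] continues with the next pair, and
    [inr] requests a counter operation first. *)
Definition action (m : mode) (y v : bool) : mode + op :=
  match (if m is Wait then if y then Cmp else SkipA else m), v with
  | SkipA, false => inl SkipA
  | SkipA, true => inl SkipB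
  | SkipB, false => inl SkipB
  | SkipB, true => inl Wait
  | Cmp, false => inr Dec
  | Cmp, true => inr Zero
  | Fill, false => inr Inc
  | Fill, true => inl Wait
  | Wait, _ => inl Wait
  end.

(* With [x (+) y] on the input tape, the cells [2n] and [2n+1] hold the n-th bits
   of [x] and [y]; the first pair is ignored.  The value [c] of the counter is
   kept as the block of ones [0 .. c] on the scratch tape.  On the output tape, 1
   marks the cell 0 and, during an operation on the counter, the cell to return
   to.  A successful zero test flashes a 1 in cell 0 of the input tape. *)
Definition counter_program (q : cstates) (b : bool * bool * bool) :
    cstates * (bool * bool * bool) * direction :=
  let: (i, s, o) := b in
  match q with
  | Start => (Second, (false, true, true), MoveRight)
  | Second => (ReadX Wait, b, MoveRight)
  | ReadX m => (ReadY m i, b, MoveRight)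
  | ReadY m v =>
      match action m i v with
      | inl m' => (ReadX m', b, MoveRight)
      | inr f => (Seek f, (i, s, true), MoveLeft)
      end
  | Seek f =>
      if s then
        match f with
        | Dec => if o then (Dead, b, MoveRight) else (Return Cmp, (i, false, o), MoveRight)
        | Zero => if o then (Flash, (true, s, o), MoveLeft) else (Dead, b, MoveRight)
        | Inc => (Push, b, MoveRight)
        end
      else (Seek f, b, MoveLeft)
  | Push => (Return Fill, (i, true, o), MoveRight)
  | Flash => (Return Fill, (false, s, o), MoveRight)
  | Return m => if o then (ReadX m, (i, s, false), MoveRight) else (Return m, b, MoveRight)
  | Limit => (Halt, (i, s, i), MoveRight)
  | Dead | Halt => (Dead, b, MoveRight)
  end.

Lemma counter_special : uniq [:: Start; Limit; Halt].
Proof. by rewrite /= !inE -!(inj_eq (can_inj cstates_codeK)) -!val_eqE /= !inordK. Qed.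

Definition counter_machine : ittm :=
  {| program := counter_program; special_states_distinct := counter_special |}.

Local Notation M := counter_machine.
Local Notation cstep := (@step M).

Lemma buchi_counter : buchi_machine M.
Proof.
split=> [[[i s] o]|z n] //.
(* [Halt] is entered only from [Limit], and no program step leads to [Limit], so neither occurs at a
   finite stage. *)
have inv q b : q <> Limit -> q <> Halt ->
    (counter_program q b).1.1 <> Limit /\ (counter_program q b).1.1 <> Halt.
  case: b => [[i s] o]; case: q => //= [m v|f|m] _ _.
  - by case: action.
  - by case: s; case: f; case: o.
  - by case: o.
suff: cstate (iter n cstep (init_config M z)) <> Limit /\
    cstate (iter n cstep (init_config M z)) <> Halt by case.
elim: n => [//|n [nl nh]]; rewrite iterS.
move: (iter n _ _) nl nh => c nl nh.
have -> : cstate (cstep c) = (program (cstate c)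
    (cinput c (chead c), cscratch c (chead c), coutput c (chead c))).1.1.
  by rewrite /step; case: program => [[q [[bi bs] bo]] d].
exact: inv.
Qed.

(** The final configuration is excluded from the second condition, so that segments can be
    concatenated. *)
Definition quiet k (c c' : config M) : Prop :=
  iter k cstep c = c' /\ forall i, i < k -> cinput (iter i cstep c) 0 = false.

Lemma quiet0 c : quiet 0 c c.
Proof. by []. Qed.

Lemma quietS k c c' : cinput c 0 = false -> quiet k (cstep c) c' -> quiet k.+1 c c'.
Proof. by move=> c0 [kc qc]; split=> [|[|i] ik] //; rewrite iterSr //; apply: qc. Qed.

Lemma quietD k l c c' c'' : quiet k c c' -> quiet l c' c'' -> quiet (k + l) c c''.
Proof.
move=> [kc qc] [lc qc']; split=> [|i ikl]; first by rewrite addnC iterD kc.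
have [|ki] := ltnP i k; first exact: qc.
by rewrite -(subnK ki) iterD kc; apply: qc'; rewrite ltn_subLR.
Qed.

Lemma write_id (t : nat -> bool) h : write t h (t h) = t.
Proof. by apply/funext => n; rewrite /write; case: eqP => // ->. Qed.

Lemma write_eq (t t' : nat -> bool) h b : t' h = b ->
  (forall n, n != h -> t' n = t n) -> write t h b = t'.
Proof. by move=> th tt'; apply/funext => n; rewrite /write; case: eqP => [->|/eqP /tt']. Qed.

(** * Simulation of one transition of the counter automaton *)

Section Macro.
Variables (inp : nat -> bool) (inp0 : inp 0 = false).

Definition block c : nat -> bool := fun n => n <= c.
Definition marks r : nat -> bool := fun n => (n == 0) || (n == r).

Lemma seek_quiet f c r k : c + k < r ->
  quiet k (@Config M (Seek f) (c + k) inp (block c) (marks r))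
          (@Config M (Seek f) c inp (block c) (marks r)).
Proof.
elim: k => [|k IH] ckr; first by rewrite addn0; apply: quiet0.
apply: quietS => //; rewrite /step /=.
have -> : block c (c + k.+1) = false by rewrite /block; lia.
rewrite !write_id (_ : write _ _ false = block c); last first.
  by apply: write_eq => //; rewrite /block; lia.
by rewrite addnS /=; apply: IH; lia.
Qed.

Lemma return_quiet m c p k : 0 < p ->
  quiet k.+1 (@Config M (Return m) p inp (block c) (marks (p + k)))
          (@Config M (ReadX m) (p + k).+1 inp (block c) (marks 0)).
Proof.
elim: k p => [|k IH] p p0; apply: quietS => //; rewrite /step /=.
- rewrite addn0; have -> : marks p p = true by rewrite /marks eqxx orbT.
  rewrite !write_id (_ : write _ _ false = marks 0).
    exact: quiet0.
  by apply: write_eq => [|n]; rewrite /marks; lia.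
- have -> : marks (p + k.+1) p = false by rewrite /marks; lia.
  rewrite !write_id (_ : write _ _ false = marks (p + k.+1)); last first.
    by apply: write_eq => //; rewrite /marks; lia.
  by rewrite -addSnnS; apply: IH.
Qed.

Lemma dead_quiet p s o i : cinput (iter i cstep (@Config M Dead p inp s o)) 0 = false.
Proof. by elim: i p => [//|i IH] p; rewrite iterSr /step /= !write_id. Qed.

Lemma quiet_forever k c c' : quiet k c c' ->
  (forall i, cinput (iter i cstep c') 0 = false) ->
  forall i, cinput (iter i cstep c) 0 = false.
Proof.
move=> [kc qc] H i; have [|ki] := ltnP i k; first exact: qc.
by rewrite -(subnK ki) iterD kc.
Qed.

Definition main m n c := @Config M (ReadX m) n.*2 inp (block c) (marks 0).

(** The abstract automaton that the machine implements, one transition per pair of cells; [None] is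
    the dead state, reached by decrementing zero or by failing a zero test. *)
Definition next (mc : mode * nat) (v y : bool) : option (mode * nat) :=
  let: (m, c) := mc in
  match action m y v, c with
  | inl m', _ => Some (m', c)
  | inr Inc, _ => Some (Fill, c.+1)
  | inr Dec, c'.+1 => Some (Cmp, c')
  | inr Zero, 0 => Some (Fill, 0)
  | _, _ => None
  end.

Definition flashes (mc : mode * nat) (v y : bool) : bool :=
  if action mc.1 y v is inr Zero then mc.2 == 0 else false.

Lemma main_read m n c : 
  let c' := @Config M (ReadY m (inp n.*2)) n.*2.+1 inp (block c) (marks 0) in
  quiet 1 (main m n c) c'.
Proof. by apply: quietS => //; rewrite /step /= !write_id; apply: quiet0. Qed.

Lemma main_seek m n c f : c < n -> action m (inp n.*2.+1) (inp n.*2) = inr f ->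
  exists k, quiet k.+2 (main m n c)
    (@Config M (Seek f) c inp (block c) (marks n.*2.+1)).
Proof.
move=> cn af; exists (n.*2 - c).
rewrite -addn2 addnC -[2]/(1 + 1) -addnA; apply: quietD (main_read _ _ _) _.
apply: quietS => //; rewrite /step /= af /= !write_id.
rewrite (_ : write _ _ true = marks n.*2.+1); last first.
  by apply: write_eq => [|k]; rewrite /marks ?eqxx ?orbT //; lia.
have := @seek_quiet f c n.*2.+1 (n.*2 - c); rewrite subnKC; last by lia.
by apply; lia.
Qed.

(** The counter grows by at most one per pair, so [c < n] is an invariant. It keeps the block of
    ones to the left of the pair being read. *)
Lemma main_next m n c m' c' : 0 < n -> c < n ->
  next (m, c) (inp n.*2) (inp n.*2.+1) = Some (m', c') ->
  c' < n.+1 /\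
  if flashes (m, c) (inp n.*2) (inp n.*2.+1) then
    exists k i, [/\ i < k, iter k cstep (main m n c) = main m' n.+1 c' &
      cinput (iter i cstep (main m n c)) 0]
  else exists k, quiet k.+1 (main m n c) (main m' n.+1 c').
Proof.
move=> n0 cn; rewrite /next /flashes; set a := action _ _ _.
case E : a => [m1|f] /=.
  move=> [<- <-]; split; first by lia.
  exists 1; rewrite -[2]/(1 + 1); apply: quietD (main_read _ _ _) _.
  apply: quietS => //; rewrite /step /= -/a E /= !write_id.
  exact: quiet0.
have [k qk] := main_seek cn E; case: f E qk => E qk.
- case: c cn qk => // c cn qk [<- <-]; split; first by lia.
  (* After the decrement the head is on cell [c.+2], at distance [l] from the mark. *)
  pose l := n.*2.+1 - c.+2; exists (k.+1 + l.+2)%N.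
  rewrite -addSn; apply: quietD qk _; apply: quietS => //.
  rewrite /step /=; have -> : block c.+1 c.+1 by rewrite /block.
  have -> : marks n.*2.+1 c.+1 = false by rewrite /marks; lia.
  rewrite /= !write_id (_ : write _ _ false = block c); last first.
    by apply: write_eq => [|i]; rewrite /block; lia.
  rewrite (_ : write _ _ false = marks (c.+2 + l)); last first.
    by apply: write_eq => [|i]; rewrite /marks /l; lia.
  rewrite /main (_ : n.+1.*2 = (c.+2 + l).+1); last by rewrite /l; lia.
  exact: return_quiet.
- case: c cn qk => // cn [kc qk] [<- <-]; split => //=.
  pose l := n.*2.+1 - 1.
  pose c2 := @Config M (Return Fill) 1 inp (block 0) (marks (1 + l)).
  have [lc _] : quiet l.+1 c2 (main Fill n.+1 0).
    rewrite /main (_ : n.+1.*2 = (1 + l).+1); last by rewrite /l; lia.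
    exact: return_quiet.
  have l1 : 1 + l = n.*2.+1 by rewrite /l; lia.
  (* After [k.+2] steps the head is on cell 0. One step writes the flash and the next one clears it,
     since a left move from cell 0 stays there; [l.+1] steps lead back. *)
  exists (l.+1 + (2 + k.+2)), (1 + k.+2); split; first by lia.
    rewrite iterD iterD kc -lc; congr (iter _ _ _).
    rewrite /= /step /= /c2 l1; f_equal; rewrite ?write_id //.
    - by apply/funext => i; rewrite /write; case: eqP => // ->.
  by rewrite iterD kc /= /step /=.
- move=> [<- <-]; split; first by lia.
  (* Moving to the first blank cell and filling it precede the return, hence [l.+3]. *)
  pose l := n.*2.+1 - c.+2; exists (k.+1 + l.+3)%N.
  rewrite -addSn; apply: quietD qk _; apply: quietS => //.
  rewrite /step /=; have -> : block c c by rewrite /block.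
  rewrite /= (_ : write (block c) c true = block c); last first.
    by apply: write_eq => //; rewrite /block leqnn.
  rewrite !write_id; apply: quietS => //; rewrite /step /= !write_id.
  rewrite (_ : write _ _ true = block c.+1); last first.
    by apply: write_eq => [|i]; rewrite /block; lia.
  have -> : n.*2.+1 = c.+2 + l by rewrite /l; lia.
  rewrite /main (_ : n.+1.*2 = (c.+2 + l).+1); last by rewrite /l; lia.
  exact: return_quiet.
Qed.

Lemma main_dead m n c : c < n ->
  next (m, c) (inp n.*2) (inp n.*2.+1) = None ->
  forall i, cinput (iter i cstep (main m n c)) 0 = false.
Proof.
move=> cn; rewrite /next; set a := action _ _ _.
case E : a => [//|f] /=.
have [k qk] := main_seek cn E; case: f E qk => E qk //; case: c cn qk => [|c] cn qk // _.
- apply: (quiet_forever qk) => -[//|i]; rewrite iterSr /step /=.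
  by rewrite !write_id; apply: dead_quiet.
- apply: (quiet_forever qk) => -[//|i]; rewrite iterSr /step /=.
  have -> : block c.+1 c.+1 by rewrite /block.
  have -> : marks n.*2.+1 c.+1 = false by rewrite /marks; lia.
  by rewrite /= !write_id; apply: dead_quiet.
Qed.

End Macro.

#[local] Arguments next : simpl never.
#[local] Arguments flashes : simpl never.

(** * Acceptance as infinitely many flashes of the automaton *)

Section Automaton.
Variables x y : nat -> bool.
Let inp := write (interleave x y) 0 false.
Let inp0 : inp 0 = false := erefl.
Let init := init_config M (interleave x y).

Fixpoint arun k : option (mode * nat) :=
  if k is k'.+1 then obind (fun mc => next mc (x k) (y k)) (arun k')
  else Some (Wait, 0).

Definition aflash k : bool :=
  if arun k is Some mc then flashes mc (x k.+1) (y k.+1) else false.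

Lemma inp_even k : inp k.+1.*2 = x k.+1.
Proof. by rewrite /inp /write /interleave odd_double doubleK. Qed.

Lemma inp_odd k : inp k.+1.*2.+1 = y k.+1.
Proof. by rewrite /inp /write /interleave oddS odd_double /= uphalf_double. Qed.

Lemma arun_reach k :
  if arun k is Some (m, c) then
    c < k.+1 /\ exists2 t, k <= t & iter t cstep init = main inp m k.+1 c
  else exists t, forall i, cinput (iter (i + t) cstep init) 0 = false.
Proof.
elim: k => [|k].
  (* The states [Start] and [Second] take two steps to clear cell 0 and pass the ignored pair. *)
  split=> //; exists 2 => //.
  rewrite /= /step /= /main /inp; f_equal.
  - exact: write_eq.
  - by apply/funext => -[|[|n]].
  - by apply/funext => -[|[|n]].
rewrite [arun k.+1]/=; case: (arun k) => [[m c] [ck [t kt tE]]|//] /=.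
case E: (next _ _ _) => [[m' c']|].
  have [|c'k] := main_next inp0 (m := m) (m' := m') (c' := c') (ltn0Sn k) ck.
    by rewrite inp_even inp_odd.
  move=> H; split=> //; case: ifP H => _.
  - move=> [l [i [il lE _]]]; exists (l + t); last by rewrite iterD tE.
    lia.
  - by move=> [l [lE _]]; exists (l.+1 + t); [lia|rewrite iterD tE].
exists t => i; rewrite iterD tE; apply: main_dead => //.
by rewrite inp_even inp_odd.
Qed.

Lemma arun_quiet N : (forall k, N <= k -> aflash k = false) ->
  forall i k, N <= k -> if arun k is Some (m, c) then
    cinput (iter i cstep (main inp m k.+1 c)) 0 = false else True.
Proof.
move=> nf i; elim/ltn_ind: i => i IH k Nk.
have := arun_reach k; case E: (arun k) => [[m c]|//] [ck _].
have := nf k Nk; rewrite /aflash E => nfk.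
case E': (next (m, c) (x k.+1) (y k.+1)) => [[m' c']|]; last first.
  by apply: main_dead => //; rewrite inp_even inp_odd.
have [|c'k] := main_next inp0 (m := m) (m' := m') (c' := c') (ltn0Sn k) ck.
  by rewrite inp_even inp_odd.
rewrite inp_even inp_odd nfk => -[l [lE ql]].
have [|li] := ltnP i l.+1; first exact: ql.
rewrite -(subnK li) iterD lE.
have := IH (i - l.+1) _ k.+1 (leqW Nk); rewrite /= E /= E'; apply; lia.
Qed.

Lemma counter_accepts : accepts M (interleave x y) <->
  forall N, exists2 k, N <= k & aflash k.
Proof.
have [_ ->] := buchi_accepts (interleave x y) buchi_counter; split=> H N.
- apply: contrapT => nf.
  have {}nf k : N <= k -> aflash k = false.
    by move=> Nk; apply/negP => fk; apply: nf; exists k.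
  have [t qt] : exists t, forall i, cinput (iter (i + t) cstep init) 0 = false.
    have := arun_reach N; have := arun_quiet nf; case E: (arun N) => [[m c]|//] q [_ [t _ tE]].
    by exists t => i; rewrite iterD tE; have := q i N (leqnn N); rewrite E.
  have [k tk] := H t; by rewrite -(subnK tk) qt.
- have [k Nk] := H N; have := arun_reach k; rewrite /aflash.
  case E: (arun k) => [[m c]|//] [ck [t kt tE]] fk.
  (* Another flash beyond [k] shows that the automaton survives the next pair, so [main_next]
     applies. *)
  have [[m' c'] E'] : exists mc, next (m, c) (x k.+1) (y k.+1) = Some mc.
    have [l kl] := H k.+1; rewrite /aflash.
    have : arun k.+1 = next (m, c) (x k.+1) (y k.+1) by rewrite /= E.
    case: next => [mc _ _|nk]; first by exists mc.
    suff -> : arun l = None by [].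
    by rewrite -(subnK kl); elim: (l - k.+1) => [//|i IH]; rewrite addSn /= IH.
  have [|c'k] := main_next inp0 (m := m) (m' := m') (c' := c') (ltn0Sn k) ck.
    by rewrite inp_even inp_odd.
  rewrite inp_even inp_odd fk => -[l [i [il _ ci]]].
  by exists (i + t); [lia|rewrite iterD tE].
Qed.

End Automaton.

(** * The automaton on one listed edge *)

Section Stage.
Variables x y : nat -> bool.

(** Anticipating the choice made in [Wait] lets one invariant cover the first pair of a stage as
    well, also when [a] is 0 and this pair already ends the first block. *)
Definition resolve (mc : mode * nat) (b : bool) : mode * nat :=
  if mc.1 is Wait then (if b then Cmp else SkipA, mc.2) else mc.

Lemma next_resolve mc v b : next mc v b = next (resolve mc b) v b.
Proof. by case: mc => [[] c]; case: b; case: v. Qed.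

Lemma flashes_resolve mc v b : flashes mc v b = flashes (resolve mc b) v b.
Proof. by case: mc => [[] c]; case: b; case: v. Qed.

Lemma flashes0 mc b : flashes mc false b = false.
Proof. by case: mc => [[] c]; case: b. Qed.

Variables p a b c : nat.
Hypothesis Wp : arun x y p = Some (Wait, c).
Hypothesis za : forall i, i < a -> x (p + i).+1 = false.
Hypothesis oa : x (p + a).+1.
Hypothesis zb : forall i, i < b -> x (p + a.+1 + i).+1 = false.
Hypothesis ob : x (p + a.+1 + b).+1.

Lemma stage_first i : i <= a ->
  omap (resolve^~ (y (p + i).+1)) (arun x y (p + i)) =
  if y p.+1 then if i <= c then Some (Cmp, c - i) else None else Some (SkipA, c).
Proof.
elim: i => [|i IH] ia; first by rewrite addn0 Wp /= subn0; case: (y _).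
rewrite addnS /=; move: (IH (ltnW ia)); case: (arun x y (p + i)) => [mc|]; last first.
  case: (y p.+1) => //; case: (leqP i c) => // ic _.
  by rewrite ltnNge (ltnW ic).
move=> /=; rewrite next_resolve za //; case: (y p.+1).
- case: (leqP i c) => // ic [->]; have [ic'|ic'] := ltnP i c.
  + have -> : c - i = (c - i.+1).+1 by lia.
    by [].
  + have -> : c - i = 0 by lia.
    by [].
- by move=> [->]; rewrite /next; case: (y (p + i).+1).
Qed.

Lemma stage_mid : arun x y (p + a).+1 =
  if y p.+1 then if a == c then Some (Fill, 0) else None else Some (SkipB, c).
Proof.
have := stage_first (leqnn a); rewrite /=; case: (arun x y (p + a)) => [mc|] /=; last first.
  by case: (y p.+1) => //; case: ltngtP.
rewrite next_resolve oa; case: (y p.+1).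
- case: leqP => // ac [->]; rewrite /next /action /=.
  by case: (a =P c) => [->|ne]; [rewrite subnn|rewrite (_ : c - a = (c - a).-1.+1) //; lia].
- by move=> [->].
Qed.

Lemma stage_last i : i <= b -> arun x y (p + a.+1 + i) =
  if y p.+1 then if a == c then Some (Fill, i) else None else Some (SkipB, c).
Proof.
elim: i => [|i IH] ib; first by rewrite addn0 addnS stage_mid.
rewrite addnS /= (IH (ltnW ib)); case: (y p.+1); last by rewrite /= zb.
by case: (a =P c) => //= _; rewrite zb.
Qed.

(** A skipped edge keeps the counter. A followed edge must start at the counter value and replaces
    it by [b], counted up from zero. *)
Lemma stage_end : arun x y (p + a.+1 + b.+1) =
  if y p.+1 then if a == c then Some (Wait, b) else None else Some (Wait, c).
Proof.
rewrite addnS /= (stage_last (leqnn b)); case: (y p.+1); last by rewrite /= ob.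
by case: (a =P c) => //= _; rewrite ob.
Qed.

(** A zero test needs a one read in the resolved mode [Cmp], which happens only at the end of the
    first block of a chosen stage. *)
Lemma stage_flash k : p <= k < p + a.+1 + b.+1 ->
  aflash x y k = [&& y p.+1, a == c & k == p + a].
Proof.
move=> /andP [pk kp]; rewrite /aflash.
have [ka|ka|->] := ltngtP k (p + a); rewrite ?andbF ?andbT.
- rewrite -(subnKC pk) za; last by lia.
  by case: arun => // mc; rewrite flashes0.
- pose i := k - (p + a.+1); have -> : k = p + a.+1 + i by rewrite /i; lia.
  rewrite stage_last; last by rewrite /i; lia.
  by case: (y p.+1) => //; case: (a =P c) => // _; case: (x _); case: (y _).
- have := stage_first (leqnn a); case: (arun x y (p + a)) => [mc|] /=.
  + rewrite flashes_resolve oa; case: (y p.+1).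
    * case: leqP => // ac [->]; rewrite /flashes /=; case: (y _) => //=; lia.
    * by move=> [->]; rewrite /flashes; case: (y _).
  + case: (y p.+1) => //; case: leqP => // ac _; lia.
Qed.

End Stage.

(** * The diagonal *)

(** This makes liveness of [j] a question about at most [j] bits, all of which are written before
    stage [j]. *)
Lemma size_decode j : size (CodeSeq.decode j) <= j.
Proof.
rewrite -{2}(CodeSeq.decodeK j); elim: (CodeSeq.decode j) => //= n s IH.
have := leq_pmull (CodeSeq.code s).*2.+1 (expn_gt0 2 n); rewrite /CodeSeq.code /= in IH *.
by lia.
Qed.

(** Children have larger codes than their parents, so the edges along a branch are listed in the
    order in which they must be followed. *)
Lemma code_cons n s : CodeSeq.code s < CodeSeq.code (n :: s).
Proof.
have n2 : 0 < 2 ^ n by rewrite expn_gt0.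
have := leq_pmull (CodeSeq.code s).*2.+1 n2; rewrite /CodeSeq.code /=.
by lia.
Qed.

Section Diagonal.
Variable C : (nat -> bool) -> (nat -> nat) -> Prop.

(* Finite sequences of naturals are coded in reverse, so that [behead] is the
   parent in the tree of [C] at the real [false :: s]. *)
Definition live j (s : seq bool) : Prop :=
  CodeSeq.decode j <> [::] /\ exists x w,
    [/\ agree (size (CodeSeq.decode j)) (nth false (false :: s)) x,
        agree (size (CodeSeq.decode j)) (nth 0 (rev (CodeSeq.decode j))) w & C x w].

(** A sequence outside the tree gets the source [j.+1]. The counter before stage [j] is at most [j],
    so this edge can never be followed. The root is excluded from [live] and treated likewise. *)
Definition source j s : nat :=
  if `[< live j s >] then CodeSeq.code (behead (CodeSeq.decode j)) else j.+1.

(** Stage [i] is the edge from its source to [i], and its source is computed from the prefix built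
    so far; this is where the real refers to itself. *)
Fixpoint prefix_upto j : seq bool :=
  if j is i.+1 then
    let s := prefix_upto i in
    s ++ nseq (source i s) false ++ true :: nseq i false ++ [:: true]
  else [::].

Definition position j : nat := size (prefix_upto j).
Definition src j : nat := source j (prefix_upto j).

Lemma positionS j : position j.+1 = position j + (src j).+1 + j.+1.
Proof. by rewrite /position /= !size_cat /= !size_cat !size_nseq /= -/(src j); lia. Qed.

Lemma position_mono : {homo position : i j / i < j}.
Proof. by apply: homo_ltn => [|j]; [exact: ltn_trans|rewrite positionS; lia]. Qed.

Lemma position_ge j : j <= position j.
Proof. by elim: j => // j IH; rewrite positionS; lia. Qed.

(** Bit 0 falls into the ignored first pair; the list [prefix_upto k.+1] is long enough to have an
    entry [k]. *)
Definition diag (n : nat) : bool :=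
  if n is k.+1 then nth false (prefix_upto k.+1) k else false.

Lemma prefix_nth i j k : i <= j -> k < position i ->
  nth false (prefix_upto j) k = nth false (prefix_upto i) k.
Proof.
move=> /subnKC <-; elim: (j - i) => [|d IH] ki; first by rewrite addn0.
rewrite addnS /= nth_cat -/(position _) (leq_trans ki) ?IH //.
by have := @position_mono i (i + d); case: d {IH} => [|d]; rewrite ?addn0 //; lia.
Qed.

Lemma diag_prefix j k : k < position j -> diag k.+1 = nth false (prefix_upto j) k.
Proof.
move=> kj; rewrite /diag; have [kj'|jk] := leqP k.+1 j; last by rewrite (@prefix_nth j) //; lia.
by rewrite -(@prefix_nth k.+1 j) //; apply: position_ge.
Qed.

Lemma diag_stage j (p := position j) (a := src j) :
  [/\ forall i, i < a -> diag (p + i).+1 = false, diag (p + a).+1,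
    forall i, i < j -> diag (p + a.+1 + i).+1 = false & diag (p + a.+1 + j).+1].
Proof.
have E i : i < a.+1 + j.+1 -> diag (p + i).+1 =
    nth false (nseq a false ++ true :: nseq j false ++ [:: true]) i.
  move=> ia; rewrite (@diag_prefix j.+1); last by rewrite positionS /p -/a; lia.
  by rewrite /= nth_cat ltnNge leq_addr /= addKn.
split=> [i ia||i ij|]; rewrite -?addnA E ?nth_cat ?size_nseq; try lia.
- by rewrite ia nth_nseq ia.
- by rewrite ltnn subnn.
- rewrite ltnNge leqW ?leq_addr //= (_ : a.+1 + i - a = i.+1) /=; last by lia.
  by rewrite nth_cat size_nseq ij nth_nseq ij.
- rewrite ltnNge leqW ?leq_addr //= (_ : a.+1 + j - a = j.+1) /=; last by lia.
  by rewrite nth_cat size_nseq ltnn subnn.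
Qed.

(** * Runs of the automaton on the diagonal real *)

Section Witness.
Variable y : nat -> bool.

Definition chosen j : bool := y (position j).+1.

Fixpoint counter j : option nat :=
  if j is i.+1 then
    obind (fun c => if chosen i then if src i == c then Some i else None else Some c)
      (counter i)
  else Some 0.

Definition success j : bool := chosen j && (counter j == Some (src j)).

Lemma arun_counter j : arun diag y (position j) = omap (pair Wait) (counter j).
Proof.
elim: j => // j IH; rewrite positionS [counter j.+1]/=.
have [za oa zb ob] := diag_stage j.
case: (counter j) IH => [c|] /= IH.
  by rewrite (stage_end IH za oa zb ob) -/(chosen j); case: (chosen j) => //; case: eqP.
have none k : arun diag y (position j + k) = None.
  by elim: k => [|k IHk]; rewrite ?addn0 // addnS /= IHk.
by rewrite -addnA none.
Qed.

Lemma aflash_success j k : position j <= k < position j.+1 ->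
  aflash diag y k = success j && (k == position j + src j).
Proof.
rewrite positionS => jk; have [za oa zb ob] := diag_stage j.
have := arun_counter j; rewrite /success; case: (counter j) => [c|] /= Wj.
  rewrite (stage_flash Wj za oa zb ob jk) /chosen -andbA; congr andb.
  by rewrite eq_sym.
rewrite andbF /=; rewrite /aflash; case/andP: jk => jk _.
suff -> : arun diag y k = None by [].
by rewrite -(subnKC jk); elim: (k - _) => [|i IH]; rewrite ?addn0 // addnS /= IH.
Qed.

Lemma flash_success : (forall N, exists2 k, N <= k & aflash diag y k) <->
  forall N, exists2 j, N <= j & success j.
Proof.
split=> H N.
- have [k Nk fk] := H (position N).
  have [j jk] : exists j, position j <= k < position j.+1.
    have [j jP] := @ex_maxnP (fun j => position j <= k) k (ex_intro _ N Nk)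
      (fun j jk => leq_trans (position_ge j) jk).
    move=> jmax; exists j; rewrite jP ltnNge; apply/negP => /jmax.
    by rewrite ltnn.
  exists j; last by move: fk; rewrite (aflash_success jk) => /andP [].
  rewrite leqNgt; apply/negP => jN; case/andP: jk => _.
  rewrite ltnNge => /negP; apply; apply: leq_trans Nk.
  have := @position_mono j.+1 N; move: jN.
  by rewrite leq_eqVlt => /orP [/eqP->//|/[swap]/[apply]/ltnW].
- have [j Nj sj] := H N; exists (position j + src j).
    by apply: leq_trans (leq_addr _ _); apply: leq_trans (position_ge j).
  by rewrite (@aflash_success j) ?sj ?eqxx // positionS; lia.
Qed.

End Witness.

Hypothesis closedC : closed_rel C.

(** The counter never dies, so every chosen stage extends the current sequence by one entry. The
    sequences along the run therefore form a branch, and closedness puts its limit into [C]. *)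
Lemma success_branch y : (forall N, exists2 j, N <= j & success y j) ->
  exists w, C diag w.
Proof.
move=> H.
have /choice [c cE] : forall j, exists c, counter y j = Some c.
  move=> j; have [k jk /andP [_ /eqP ck]] := H j.
  case E: (counter y j) => [c|]; first by exists c.
  have : counter y k = None.
    by rewrite -(subnKC jk); elim: (k - j) => [|i IH]; rewrite ?addn0 // addnS /= IH.
  by rewrite ck.
have c0 : c 0 = 0 by have := cE 0 => -[].
have cS j : c j.+1 = if chosen y j then j else c j.
  have := cE j.+1; rewrite /= cE /=; case: (chosen y j) => [|[]//].
  by case: eqP => // _ [].
have c_lt j : c j < j.+1.
  by elim: j => [|j IH]; rewrite ?c0 // cS; case: ifP => _; rewrite // ltnW.
pose d j := CodeSeq.decode (c j).
have succP j : chosen y j -> live j (prefix_upto j) /\ exists n, d j.+1 = n :: d j.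
  move=> cj; have := cE j.+1; rewrite /= cE /= cj; case: eqP => // + _.
  rewrite /src /source; case: asboolP => [lj|_ E]; last first.
    by have := c_lt j; rewrite -E ltnn.
  move=> E; split=> //; have [ne _] := lj.
  rewrite /d cS cj -E CodeSeq.codeK; case: (CodeSeq.decode j) ne => // n t _.
  by exists n.
have dS j : exists t, d j.+1 = t ++ d j.
  have := succP j; have := cS j; case: (chosen y j) => [_ /(_ isT) [_ [n ->]]|E _].
    by exists [:: n].
  by exists [::]; rewrite /d E.
have dle j k : j <= k -> exists t, d k = t ++ d j.
  move=> /subnKC <-; elim: (k - j) => [|i [t IH]]; first by exists [::]; rewrite addn0.
  by rewrite addnS; have [t' ->] := dS (j + i); exists (t' ++ t); rewrite IH catA.
have big N : exists j, chosen y j /\ N <= size (d j.+1).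
  elim: N => [|N [j [_ Nj]]]; first by have [j _ /andP [cj _]] := H 0; exists j.
  have [k jk /andP [ck _]] := H j.+1; exists k; split=> //.
  have [_ [n ->]] := succP k ck; have [t ->] := dle _ _ jk.
  by rewrite /= size_cat; lia.
have /choice [J JP] : forall n, exists j, n < size (d j).
  by move=> n; have [j [_ nj]] := big n.+1; exists j.+1.
pose w n := nth 0 (rev (d (J n))) n.
have wE j n : n < size (d j) -> nth 0 (rev (d j)) n = w n.
  have sub i k : i <= k -> n < size (d i) -> nth 0 (rev (d k)) n = nth 0 (rev (d i)) n.
    by move=> /dle [t ->] ni; rewrite rev_cat nth_cat size_rev ni.
  move=> nj; rewrite /w; have [jJ|/ltnW Jj] := leqP j (J n); first by rewrite (sub _ _ jJ).
  by rewrite (sub _ _ Jj).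
(* The chosen stage [j] leads to a live sequence of length at least [n], and liveness supplies a
   point of [C] that agrees with [diag] and [w] that far. *)
exists w; apply: closedC => n; have [j [cj nj]] := big n.
have [[_ [x' [w' [xx' ww' Cx]]]] _] := succP j cj.
have dj : CodeSeq.decode j = d j.+1 by rewrite /d cS cj.
exists x', w'; split=> // i ni.
- have ij : i < size (CodeSeq.decode j) by rewrite dj; apply: leq_trans nj.
  rewrite -xx' //; case: i ni ij => [//|i] ni ij /=.
  by apply: diag_prefix; apply: leq_trans (position_ge j); have := size_decode j; lia.
- have ij : i < size (d j.+1) by apply: leq_trans nj.
  by rewrite -ww' ?dj // wE.
Qed.

(** The guess follows exactly the edges into the initial segments of [w]. They are live because
    [diag] and [w] themselves are witnesses. *)
Lemma branch_success w : C diag w -> exists y, forall N, exists2 j, N <= j & success y j.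
Proof.
move=> Cw; pose node i := CodeSeq.code (rev (mkseq w i)).
have node0 : node 0 = 0 by [].
have nodeE i : CodeSeq.decode (node i.+1) = w i :: rev (mkseq w i).
  by rewrite CodeSeq.codeK mkseqS rev_rcons.
have nodeS i : node i < node i.+1.
  by rewrite {2}/node mkseqS rev_rcons; apply: code_cons.
have node_mono : {homo node : i j / i < j} by apply: homo_ltn => //; exact: ltn_trans.
have node_src i : src (node i.+1) = node i.
  rewrite /src /source; set s := prefix_upto _.
  have -> : `[< live (node i.+1) s >].
    apply/asboolP; split; first by rewrite nodeE.
    exists diag, w; split=> // k; rewrite CodeSeq.codeK size_rev size_mkseq => ki.
    - case: k ki => [//|k] ki; rewrite [LHS]/= (@diag_prefix (node i.+1)) //.
      apply: leq_trans (position_ge _); apply: leq_trans (size_decode _).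
      by rewrite CodeSeq.codeK size_rev size_mkseq; lia.
    - by rewrite revK nth_mkseq.
  by rewrite nodeE.
pose y n := `[< exists i, n = (position (node i.+1)).+1 >].
have chosenP j : chosen y j <-> exists i, j = node i.+1.
  rewrite /chosen /y; split=> [/asboolP [i [E]]|[i ->]]; last by apply/asboolP; exists i.
  exists i; have := @position_mono j (node i.+1); have := @position_mono (node i.+1) j.
  by case: ltngtP => // _; lia.
exists y.
have walk i : counter y (node i).+1 = Some (node i).
  elim: i => [|i IH].
    rewrite node0 /=; case: ifP => // /chosenP [i iE].
    by have := @node_mono 0 i.+1 isT; rewrite -iE.
  (* Between consecutive nodes of the branch no stage is chosen, so the counter waits at the earlier
     node. *)
  have stay k : node i < k <= node i.+1 -> counter y k = Some (node i).
    elim: k => [|k IHk] //; rewrite ltnS => /andP [ik ki]; move: ik.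
    rewrite leq_eqVlt => /orP [/eqP <- //|ik].
    rewrite /= IHk ?ik ?(ltnW ki) //=; case: ifP => // /chosenP [l lE].
    have il : i < l.+1.
      rewrite ltnNge; apply/negP; rewrite leq_eqVlt => /orP [/eqP E|/node_mono].
        by rewrite lE E ltnn in ik.
      by rewrite -lE; lia.
    have li : l.+1 < i.+1.
      rewrite ltnNge; apply/negP; rewrite leq_eqVlt => /orP [/eqP E|/node_mono].
        by rewrite lE -E ltnn in ki.
      by rewrite -lE; lia.
    by lia.
  have ci : chosen y (node i.+1) by apply/chosenP; exists i.
  by rewrite /= stay ?nodeS ?leqnn //= ci node_src eqxx.
have ge i : i <= node i by elim: i => // i IH; apply: leq_trans (nodeS i).
move=> N; exists (node N.+1); first by apply: leq_trans (ge _).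
have := walk N.+1; rewrite /success /=.
have -> : chosen y (node N.+1) by apply/chosenP; exists N.
case: (counter y (node N.+1)) => //= c.
by case: (src _ =P c) => // ->; rewrite eqxx.
Qed.

Lemma diag_fixpoint :
  (exists y, accepts counter_machine (interleave diag y)) <-> exists w, C diag w.
Proof.
split=> [[y /counter_accepts /flash_success]|[w /branch_success [y sy]]].
  exact: success_branch.
by exists y; apply/counter_accepts/flash_success.
Qed.

End Diagonal.

Theorem theorem3p5 : NPplus <> coNPplus.
Proof.
move=> E; have NA := buchi_NPplus buchi_counter; set A := (X in NPplus X) in NA.
have : coNPplus A by rewrite -E.
move=> /NPplus_analytic [C closedC AC].
(* [C] represents the complement of [A], while the fixed point expresses membership in [A] by the
   same condition on [C]. *)
have := AC (diag C); rewrite -(diag_fixpoint closedC) => AnA.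
have nA : ~ A (diag C) by move=> Ax; apply: (proj2 AnA Ax).
exact: (nA (proj1 AnA nA)).
Qed.
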